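(* Let $\mathfrak{A}$ be an abelian category such that $D^*(\mathfrak{A})$, with $*\in\{\emptyset,+,-,b\}$, has an almost split triangle $X^\bullet\to Y^\bullet\to Z^\bullet\to X^\bullet[1]$, where $X^\bullet$ is a bounded-below complex and $Z^\bullet$ is a bounded-above complex. (1) If $Z^\bullet$ admits a projective resolution over a strictly additive subcategory $\mathcal{P}$ of projective objects of $\mathfrak{A}$, then it admits a finite projective resolution over $\mathcal{P}$. (2) If $X^\bullet$ admits an injective co-resolution over a strictly additive subcategory $\mathcal{I}$ of injective objects of $\mathfrak{A}$, then it admits a finite injective co-resolution over $\mathcal{I}$.
   Context: For an additive category $\mathcal{B}$, $C^-(\mathcal{B}),C^+(\mathcal{B}),C^b(\mathcal{B})$ are the categories of bounded-above, bounded-below, bounded (cochain) complexes over $\mathcal{B}$; $D^*(\mathfrak{A})$ for $*\in\{\emptyset,+,-,b\}$ is the corresponding derived category of $\mathfrak{A}$. A strictly additive subcategory is a full subcategory closed under finite direct sums, direct summands and isomorphisms. A projective resolution over $\mathcal{P}$ of $Z^\bullet\in C^-(\mathfrak{A})$ is a quasi-isomorphism $P^\bullet\to Z^\bullet$ with $P^\bullet\in C^-(\mathcal{P})$; it is finite if $P^\bullet\in C^b(\mathcal{P})$. An injective co-resolution over $\mathcal{I}$ of $X^\bullet\in C^+(\mathfrak{A})$ is a quasi-isomorphism $X^\bullet\to I^\bullet$ with $I^\bullet\in C^+(\mathcal{I})$; it is finite if $I^\bullet\in C^b(\mathcal{I})$. In a triangulated category, an exact triangle $X\xrightarrow{f}Y\xrightarrow{g}Z\to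 X[1]$ is almost split if $f$ is minimal left almost split and $g$ is minimal right almost split. Here $f:X\to Y$ is left minimal if every $h:Y\to Y$ with $hf=f$ is an automorphism, left almost split if it is not a section and every non-section $X\to M$ factors through $f$, minimal left almost split if both; the right versions are dual. *)

(* Defs.v *)
From mathcomp Require Import all_boot all_order all_algebra.
From mathcomp Require Import boolp.

Set Implicit Arguments.
Unset Strict Implicit.
Unset Printing Implicit Defensive.

Import Order.TTheory GRing.Theory Num.Theory.
Local Open Scope ring_scope.

Declare Scope cat_scope.
Delimit Scope cat_scope with cat.
Open Scope cat_scope.

Reserved Notation "g ∘ f" (at level 40, left associativity).
Reserved Notation "g · f" (at level 40, left associativity).

Record category := Category {
  ob :> Type;
  hom : ob -> ob -> Type;
  idm : forall X, hom X X;
  ccomp : forall X Y Z, hom Y Z -> hom X Y -> hom X Z;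
  ccomp1m : forall X Y (f : hom X Y), ccomp (idm Y) f = f;
  ccompm1 : forall X Y (f : hom X Y), ccomp f (idm X) = f;
  ccompA : forall X Y Z W (h : hom Z W) (g : hom Y Z) (f : hom X Y),
    ccomp h (ccomp g f) = ccomp (ccomp h g) f
}.

Arguments hom {c}.
Arguments idm {c}.
Notation "g ∘ f" := (ccomp g f) : cat_scope.

Section CategoryNotions.
Variable C : category.
Implicit Types X Y Z M : C.

Definition is_iso X Y (f : hom X Y) : Prop :=
  exists g : hom Y X, g ∘ f = idm X /\ f ∘ g = idm Y.

Definition is_section X Y (f : hom X Y) : Prop :=
  exists g : hom Y X, g ∘ f = idm X.

Definition is_retraction X Y (f : hom X Y) : Prop :=
  exists g : hom Y X, f ∘ g = idm Y.

Definition left_minimal X Y (f : hom X Y) : Prop :=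
  forall h : hom Y Y, h ∘ f = f -> is_iso h.

Definition right_minimal Y Z (g : hom Y Z) : Prop :=
  forall h : hom Y Y, g ∘ h = g -> is_iso h.

Definition left_almost_split X Y (f : hom X Y) : Prop :=
  ~ is_section f /\
  forall M (u : hom X M), ~ is_section u -> exists v : hom Y M, v ∘ f = u.

Definition right_almost_split Y Z (g : hom Y Z) : Prop :=
  ~ is_retraction g /\
  forall M (u : hom M Z), ~ is_retraction u -> exists v : hom M Y, g ∘ v = u.

Definition minimal_left_almost_split X Y (f : hom X Y) : Prop :=
  left_minimal f /\ left_almost_split f.

Definition minimal_right_almost_split Y Z (g : hom Y Z) : Prop :=
  right_minimal g /\ right_almost_split g.

End CategoryNotions.

Record functor (C D : category) := Functor {
  fob :> C -> D;
  fhom : forall X Y, hom X Y -> hom (fob X) (fob Y);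
  fhom_id : forall X, fhom (idm X) = idm (fob X);
  fhom_comp : forall X Y Z (g : hom Y Z) (f : hom X Y),
    fhom (g ∘ f) = fhom g ∘ fhom f
}.

Arguments fhom {C D} F {X Y} : rename.

Definition full_subcategory (C : category) (P : C -> Prop) : category :=
  @Category {X : C | P X} (fun X Y => hom (sval X) (sval Y))
    (fun X => idm (sval X)) (fun X Y Z g f => g ∘ f)
    (fun X Y f => ccomp1m f) (fun X Y f => ccompm1 f)
    (fun X Y Z W h g f => ccompA h g f).

Definition functor_restr (C : category) (P : C -> Prop) (F : functor C C)
    (FP : forall X, P X -> P (F X)) :
    functor (full_subcategory P) (full_subcategory P) :=
  @Functor (full_subcategory P) (full_subcategory P)
    (fun X => exist P (F (sval X)) (FP _ (svalP X)))
    (fun X Y f => fhom F f)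
    (fun X => fhom_id F (sval X))
    (fun X Y Z g f => fhom_comp F g f).

(* Gabriel-Zisman localization: morphisms are finite zigzags, read from left
   to right, in which the arrows pointing backwards lie in [W], modulo the
   smallest congruence which respects identities and composition of [C] and
   makes the backward arrow of [s] inverse to the forward arrow of [s]. *)

Section Zigzag.
Variables (C : category) (W : forall X Y : C, hom X Y -> Prop).

Inductive zigzag : C -> C -> Type :=
| zz_nil X : zigzag X X
| zz_fwd X Y Z (f : hom X Y) (w : zigzag Y Z) : zigzag X Z
| zz_bwd X Y Z (s : hom Y X) (Ws : W s) (w : zigzag Y Z) : zigzag X Z.

Inductive zz_eq : forall X Y, zigzag X Y -> zigzag X Y -> Prop :=
| zz_refl X Y (w : zigzag X Y) : zz_eq w w
| zz_sym X Y (w w' : zigzag X Y) : zz_eq w w' -> zz_eq w' w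
| zz_trans X Y (w w' w'' : zigzag X Y) :
    zz_eq w w' -> zz_eq w' w'' -> zz_eq w w''
| zz_congf X Y Z (f : hom X Y) (w w' : zigzag Y Z) :
    zz_eq w w' -> zz_eq (zz_fwd f w) (zz_fwd f w')
| zz_congb X Y Z (s : hom Y X) (Ws : W s) (w w' : zigzag Y Z) :
    zz_eq w w' -> zz_eq (zz_bwd Ws w) (zz_bwd Ws w')
| zz_id X Y (w : zigzag X Y) : zz_eq (zz_fwd (idm X) w) w
| zz_comp X Y Z T (f : hom X Y) (g : hom Y Z) (w : zigzag Z T) :
    zz_eq (zz_fwd f (zz_fwd g w)) (zz_fwd (g ∘ f) w)
| zz_fb X Y Z (s : hom X Y) (Ws : W s) (w : zigzag X Z) :
    zz_eq (zz_fwd s (zz_bwd Ws w)) w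
| zz_bf X Y Z (s : hom Y X) (Ws : W s) (w : zigzag X Z) :
    zz_eq (zz_bwd Ws (zz_fwd s w)) w.

Fixpoint zz_cat X Y (u : zigzag X Y) : forall Z, zigzag Y Z -> zigzag X Z :=
  match u in zigzag X0 Y0 return forall Z, zigzag Y0 Z -> zigzag X0 Z with
  | zz_nil _ => fun Z v => v
  | zz_fwd _ _ _ f w => fun Z v => zz_fwd f (zz_cat w v)
  | zz_bwd _ _ _ s Ws w => fun Z v => zz_bwd Ws (zz_cat w v)
  end.

Lemma zz_cat_eql X Y Z (u u' : zigzag X Y) (v : zigzag Y Z) :
  zz_eq u u' -> zz_eq (zz_cat u v) (zz_cat u' v).
Proof.
move=> e; elim: e v => {X Y u u'} /=.
- by move=> *; exact: zz_refl.
- by move=> X Y w w' _ IH v; exact/zz_sym/IH.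
- by move=> X Y w w' w'' _ IH _ IH' v; exact: zz_trans (IH v) (IH' v).
- by move=> X Y Z' f w w' _ IH v; exact/zz_congf/IH.
- by move=> X Y Z' s Ws w w' _ IH v; exact/zz_congb/IH.
- by move=> *; exact: zz_id.
- by move=> *; exact: zz_comp.
- by move=> *; exact: zz_fb.
- by move=> *; exact: zz_bf.
Qed.

Lemma zz_cat_eqr X Y Z (u : zigzag X Y) (v v' : zigzag Y Z) :
  zz_eq v v' -> zz_eq (zz_cat u v) (zz_cat u v').
Proof.
elim: u v v' => {X Y} //= [X Y Y' f|X Y Y' s Ws] w IH v v' e.
- exact/zz_congf/IH.
- exact/zz_congb/IH.
Qed.

Lemma zz_cats0 X Y (u : zigzag X Y) : zz_cat u (zz_nil Y) = u.
Proof. by elim: u => {X Y} //= [X Y Z f|X Y Z s Ws] w ->. Qed.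

Lemma zz_catA X Y Z T (u : zigzag X Y) (v : zigzag Y Z) (w : zigzag Z T) :
  zz_cat (zz_cat u v) w = zz_cat u (zz_cat v w).
Proof.
by elim: u v => {X Y} //= [X Y Y' f|X Y Y' s Ws] u IH v; rewrite IH.
Qed.

(* Equivalence classes are represented as predicates: the generic quotients of
   MathComp would force the objects of [C] to live in the universe of
   [eqType], which excludes, for example, [zmodType]. *)
Definition loc_hom X Y : Type :=
  {c : zigzag X Y -> Prop | exists u, c = zz_eq u}.

Lemma loc_hom_eq X Y (f g : loc_hom X Y) : sval f = sval g -> f = g.
Proof. by case: f g => [c p] [c' p'] /= e; exact: eq_exist. Qed.

Definition loc_class X Y (u : zigzag X Y) : loc_hom X Y :=
  exist _ (zz_eq u) (ex_intro _ u erefl).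

Definition loc_word X Y (f : loc_hom X Y) : zigzag X Y :=
  sval (cid (svalP f)).

Lemma loc_classP X Y (u v : zigzag X Y) :
  loc_class u = loc_class v <-> zz_eq u v.
Proof.
split=> [[->]|e]; first exact: zz_refl.
apply: loc_hom_eq; apply/funext => w; apply/propext; split=> [uw|vw].
- exact: zz_trans (zz_sym e) uw.
- exact: zz_trans e vw.
Qed.

Lemma loc_wordK X Y (f : loc_hom X Y) : loc_class (loc_word f) = f.
Proof.
by apply: loc_hom_eq; rewrite /loc_word; case: cid => u /= ->.
Qed.

Lemma loc_classK X Y (u : zigzag X Y) : zz_eq (loc_word (loc_class u)) u.
Proof. by apply/loc_classP; rewrite loc_wordK. Qed.

Definition loc_comp X Y Z (g : loc_hom Y Z) (f : loc_hom X Y) : loc_hom X Z :=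
  loc_class (zz_cat (loc_word f) (loc_word g)).

Lemma loc_compE X Y Z (u : zigzag X Y) (v : zigzag Y Z) :
  loc_comp (loc_class v) (loc_class u) = loc_class (zz_cat u v).
Proof.
apply/loc_classP; apply: zz_trans (zz_cat_eqr _ (loc_classK v)).
exact/zz_cat_eql/loc_classK.
Qed.

Lemma loc_comp1m X Y (f : loc_hom X Y) : loc_comp (loc_class (zz_nil Y)) f = f.
Proof. by rewrite -{1}[f]loc_wordK loc_compE zz_cats0 loc_wordK. Qed.

Lemma loc_compm1 X Y (f : loc_hom X Y) : loc_comp f (loc_class (zz_nil X)) = f.
Proof. by rewrite -{1}[f]loc_wordK loc_compE loc_wordK. Qed.

Lemma loc_compA X Y Z T (h : loc_hom Z T) (g : loc_hom Y Z) (f : loc_hom X Y) :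
  loc_comp h (loc_comp g f) = loc_comp (loc_comp h g) f.
Proof.
by rewrite -[h]loc_wordK -[g]loc_wordK -[f]loc_wordK !loc_compE zz_catA.
Qed.

Definition localization : category :=
  Category loc_comp1m loc_compm1 loc_compA.

Definition loc_map (X Y : C) (f : hom X Y) : @hom localization X Y :=
  loc_class (zz_fwd f (zz_nil Y)).

End Zigzag.

Arguments loc_map {C} W {X Y} f.

Section LocalizedFunctor.
Variables (C : category) (W : forall X Y : C, hom X Y -> Prop).
Variable F : functor C C.
Hypothesis FW : forall X Y (s : hom X Y), W s -> W (fhom F s).

Fixpoint zz_map X Y (u : zigzag W X Y) : zigzag W (F X) (F Y) :=
  match u with
  | zz_nil X => zz_nil W (F X)
  | zz_fwd _ _ _ f w => zz_fwd (fhom F f) (zz_map w)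
  | zz_bwd _ _ _ s Ws w => zz_bwd (FW Ws) (zz_map w)
  end.

Lemma zz_map_eq X Y (u v : zigzag W X Y) :
  zz_eq u v -> zz_eq (zz_map u) (zz_map v).
Proof.
elim=> {X Y u v} /=.
- by move=> *; exact: zz_refl.
- by move=> X Y w w' _ IH; exact/zz_sym/IH.
- by move=> X Y w w' w'' _ IH _ IH'; exact: zz_trans IH IH'.
- by move=> X Y Z' f w w' _ IH; exact/zz_congf/IH.
- by move=> X Y Z' s Ws w w' _ IH; exact/zz_congb/IH.
- by move=> X Y w; rewrite fhom_id; exact: zz_id.
- by move=> X Y Z T f g w; rewrite fhom_comp; exact: zz_comp.
- by move=> *; exact: zz_fb.
- by move=> *; exact: zz_bf.
Qed.

Lemma zz_map_cat X Y Z (u : zigzag W X Y) (v : zigzag W Y Z) :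
  zz_map (zz_cat u v) = zz_cat (zz_map u) (zz_map v).
Proof.
by elim: u v => {X Y} //= [X Y Y' f|X Y Y' s Ws] w IH v; rewrite IH.
Qed.

Definition loc_fhom X Y (f : loc_hom W X Y) : loc_hom W (F X) (F Y) :=
  loc_class (zz_map (loc_word f)).

Lemma loc_fhomE X Y (u : zigzag W X Y) :
  loc_fhom (loc_class u) = loc_class (zz_map u).
Proof. by apply/loc_classP/zz_map_eq/loc_classK. Qed.

Lemma loc_fhom_id X :
  loc_fhom (@idm (localization W) X) = @idm (localization W) (F X).
Proof. by rewrite loc_fhomE. Qed.

Lemma loc_fhom_comp X Y Z (g : loc_hom W Y Z) (f : loc_hom W X Y) :
  loc_fhom (loc_comp g f) = loc_comp (loc_fhom g) (loc_fhom f).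
Proof.
by rewrite -[g]loc_wordK -[f]loc_wordK loc_compE !loc_fhomE loc_compE zz_map_cat.
Qed.

Definition loc_functor : functor (localization W) (localization W) :=
  @Functor (localization W) (localization W) F
    loc_fhom loc_fhom_id loc_fhom_comp.

End LocalizedFunctor.

(* The part of the structure of a triangulated category which enters the
   definition of almost split triangles. *)
Record triangle_category := TriangleCategory {
  tcat :> category;
  shift : functor tcat tcat;
  exact_triangle :
    forall X Y Z : tcat, hom X Y -> hom Y Z -> hom Z (shift X) -> Prop
}.

Arguments shift {t}.

Definition almost_split_triangle (T : triangle_category) (X Y Z : T)
    (f : hom X Y) (g : hom Y Z) (h : hom Z (shift X)) : Prop :=
  [/\ exact_triangle f g h, minimal_left_almost_split f
    & minimal_right_almost_split g].

Definition triangle_iso (C : category) (S : functor C C)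
    (X Y Z : C) (f : hom X Y) (g : hom Y Z) (h : hom Z (S X))
    (X' Y' Z' : C) (f' : hom X' Y') (g' : hom Y' Z') (h' : hom Z' (S X')) : Prop :=
  exists (a : hom X X') (b : hom Y Y') (c : hom Z Z'),
    [/\ is_iso a, is_iso b & is_iso c] /\
    [/\ b ∘ f = f' ∘ a, c ∘ g = g' ∘ b & fhom S a ∘ h = h' ∘ c].

(* Taking the morphisms in a [zmodType] only adds to an abelian group a choice
   structure, which every type has classically. *)
Record preadditive_category := PreadditiveCategory {
  pob :> Type;
  mor : pob -> pob -> zmodType;
  mid : forall X, mor X X;
  mcomp : forall X Y Z, mor Y Z -> mor X Y -> mor X Z;
  mcomp1m : forall X Y (f : mor X Y), mcomp (mid Y) f = f;
  mcompm1 : forall X Y (f : mor X Y), mcomp f (mid X) = f;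
  mcompA : forall X Y Z W (h : mor Z W) (g : mor Y Z) (f : mor X Y),
    mcomp h (mcomp g f) = mcomp (mcomp h g) f;
  mcompDl : forall X Y Z (g g' : mor Y Z) (f : mor X Y),
    mcomp (g + g') f = mcomp g f + mcomp g' f;
  mcompDr : forall X Y Z (g : mor Y Z) (f f' : mor X Y),
    mcomp g (f + f') = mcomp g f + mcomp g f'
}.

Arguments mor {p}.
Arguments mid {p}.
Notation "g · f" := (mcomp g f) : cat_scope.

Definition underlying_category (A : preadditive_category) : category :=
  @Category A (fun X Y => mor X Y) mid (@mcomp A)
    (@mcomp1m A) (@mcompm1 A) (@mcompA A).

Section Preadditive.
Variable A : preadditive_category.
Implicit Types X Y Z : A.

Lemma mcomp0m X Y Z (f : mor X Y) : (0 : mor Y Z) · f = 0.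
Proof. by apply: (addrI (0 · f)); rewrite -mcompDl !addr0. Qed.

Lemma mcompm0 X Y Z (g : mor Y Z) : g · (0 : mor X Y) = 0.
Proof. by apply: (addrI (g · 0)); rewrite -mcompDr !addr0. Qed.

Lemma mcompNm X Y Z (g : mor Y Z) (f : mor X Y) : (- g) · f = - (g · f).
Proof. by apply: (addrI (g · f)); rewrite -mcompDl !subrr mcomp0m. Qed.

Lemma mcompmN X Y Z (g : mor Y Z) (f : mor X Y) : g · (- f) = - (g · f).
Proof. by apply: (addrI (g · f)); rewrite -mcompDr !subrr mcompm0. Qed.

Definition isomorphism X Y (f : mor X Y) : Prop :=
  @is_iso (underlying_category A) X Y f.

Definition isomorphic X Y : Prop := exists f : mor X Y, isomorphism f.

Definition mono X Y (f : mor X Y) : Prop :=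
  forall W (u v : mor W X), f · u = f · v -> u = v.

Definition epi X Y (f : mor X Y) : Prop :=
  forall W (u v : mor Y W), u · f = v · f -> u = v.

Definition is_zero X : Prop :=
  (forall Y (f : mor X Y), f = 0) /\ (forall Y (f : mor Y X), f = 0).

Definition is_kernel K X Y (f : mor X Y) (k : mor K X) : Prop :=
  f · k = 0 /\
  forall W (u : mor W X), f · u = 0 -> exists! v : mor W K, k · v = u.

Definition is_cokernel X Y Q (f : mor X Y) (q : mor Y Q) : Prop :=
  q · f = 0 /\
  forall W (u : mor Y W), u · f = 0 -> exists! v : mor Q W, v · q = u.

Definition projective (P : A) : Prop :=
  forall X Y (e : mor X Y) (f : mor P Y), epi e ->
    exists g : mor P X, e · g = f.

Definition injective_object (I : A) : Prop :=
  forall X Y (m : mor X Y) (f : mor X I), mono m ->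
    exists g : mor Y I, g · m = f.

End Preadditive.

Record additive_category := AdditiveCategory {
  additive_base :> preadditive_category;
  zero_ob : additive_base;
  zero_obP : is_zero zero_ob;
  biprod : additive_base -> additive_base -> additive_base;
  inl_ : forall X Y, mor X (biprod X Y);
  inr_ : forall X Y, mor Y (biprod X Y);
  prl_ : forall X Y, mor (biprod X Y) X;
  prr_ : forall X Y, mor (biprod X Y) Y;
  prl_inl : forall X Y, prl_ X Y · inl_ X Y = mid X;
  prr_inr : forall X Y, prr_ X Y · inr_ X Y = mid Y;
  prr_inl : forall X Y, prr_ X Y · inl_ X Y = 0;
  prl_inr : forall X Y, prl_ X Y · inr_ X Y = 0;
  biprod_id : forall X Y,
    inl_ X Y · prl_ X Y + inr_ X Y · prr_ X Y = mid (biprod X Y)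
}.

Record abelian_category := AbelianCategory {
  abelian_base :> additive_category;
  ker : forall X Y : abelian_base, mor X Y -> abelian_base;
  ker_i : forall X Y (f : mor X Y), mor (ker f) X;
  ker_iP : forall X Y (f : mor X Y), is_kernel f (ker_i f);
  coker : forall X Y : abelian_base, mor X Y -> abelian_base;
  coker_p : forall X Y (f : mor X Y), mor Y (coker f);
  coker_pP : forall X Y (f : mor X Y), is_cokernel f (coker_p f);
  mono_normal : forall (X Y : abelian_base) (m : mor X Y),
    mono m -> exists Z (g : mor Y Z), is_kernel g m;
  epi_conormal : forall (X Y : abelian_base) (e : mor X Y),
    epi e -> exists Z (g : mor Z X), is_cokernel g e
}.

Section Abelian.
Variable A : abelian_category.
Implicit Types X Y Z W : A.

Lemma ker_lift_ex X Y (f : mor X Y) W (u : mor W X) (e : f · u = 0) :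
  exists v : mor W (ker f), ker_i f · v == u.
Proof. by have [v [<- _]] := (ker_iP f).2 W u e; exists v. Qed.

Definition ker_lift X Y (f : mor X Y) W (u : mor W X) (e : f · u = 0) :
  mor W (ker f) := xchoose (ker_lift_ex e).

Lemma ker_liftK X Y (f : mor X Y) W (u : mor W X) (e : f · u = 0) :
  ker_i f · ker_lift e = u.
Proof. exact/eqP/(xchooseP (ker_lift_ex e)). Qed.

Lemma ker_i_mono X Y (f : mor X Y) : mono (ker_i f).
Proof.
move=> W u v e; have [fk0 kerP] := ker_iP f.
have [|w [_ wP]] := kerP _ (ker_i f · u); first by rewrite mcompA fk0 mcomp0m.
by rewrite -(wP u erefl) -(wP v (esym e)).
Qed.

Lemma coker_desc_ex X Y (f : mor X Y) W (u : mor Y W) (e : u · f = 0) :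
  exists v : mor (coker f) W, v · coker_p f == u.
Proof. by have [v [<- _]] := (coker_pP f).2 W u e; exists v. Qed.

Definition coker_desc X Y (f : mor X Y) W (u : mor Y W) (e : u · f = 0) :
  mor (coker f) W := xchoose (coker_desc_ex e).

Lemma coker_descK X Y (f : mor X Y) W (u : mor Y W) (e : u · f = 0) :
  coker_desc e · coker_p f = u.
Proof. exact/eqP/(xchooseP (coker_desc_ex e)). Qed.

Lemma coker_p_epi X Y (f : mor X Y) : epi (coker_p f).
Proof.
move=> W u v e; have [pf0 cokerP] := coker_pP f.
have [|w [_ wP]] := cokerP _ (u · coker_p f).
  by rewrite -mcompA pf0 mcompm0.
by rewrite -(wP u erefl) -(wP v (esym e)).
Qed.

End Abelian.

(* A full subcategory is given by its class of objects.  Closure under finite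
   direct sums includes the empty one. *)
Definition strictly_additive (A : additive_category) (P : A -> Prop) : Prop :=
  [/\ P (zero_ob A),
      forall X Y : A, P X -> P Y -> P (biprod X Y),
      forall X Y : A, P (biprod X Y) -> P X /\ P Y
    & forall X Y : A, isomorphic X Y -> P X -> P Y].

Record complex (A : preadditive_category) := Complex {
  cob :> int -> A;
  diff : forall i, mor (cob i) (cob (i + 1));
  diffK : forall i, diff (i + 1) · diff i = 0
}.

Section Complexes.
Variable A : preadditive_category.
Implicit Types X Y Z : complex A.

Record chain_map X Y := ChainMap {
  cmap :> forall i, mor (X i) (Y i);
  cmapE : forall i, diff Y i · cmap i = cmap (i + 1) · diff X i
}.

Lemma chain_map_eq X Y (f g : chain_map X Y) : (forall i, f i = g i) -> f = g.
Proof.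
case: f g => [f fE] [g gE] /= fg.
have {}fg : f = g by exact: functional_extensionality_dep.
by subst g; congr ChainMap; exact: Prop_irrelevance.
Qed.

Lemma cm_id_subproof X i : diff X i · mid (X i) = mid (X (i + 1)) · diff X i.
Proof. by rewrite mcompm1 mcomp1m. Qed.

Definition cm_id X : chain_map X X := ChainMap (cm_id_subproof X).

Lemma cm_comp_subproof X Y Z (g : chain_map Y Z) (f : chain_map X Y) i :
  diff Z i · (g i · f i) = (g (i + 1) · f (i + 1)) · diff X i.
Proof. by rewrite mcompA cmapE -mcompA cmapE mcompA. Qed.

Definition cm_comp X Y Z (g : chain_map Y Z) (f : chain_map X Y) :
  chain_map X Z := ChainMap (cm_comp_subproof g f).

Lemma cm_comp1m X Y (f : chain_map X Y) : cm_comp (cm_id Y) f = f.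
Proof. by apply: chain_map_eq => i; rewrite /= mcomp1m. Qed.

Lemma cm_compm1 X Y (f : chain_map X Y) : cm_comp f (cm_id X) = f.
Proof. by apply: chain_map_eq => i; rewrite /= mcompm1. Qed.

Lemma cm_compA X Y Z W (h : chain_map Z W) (g : chain_map Y Z)
    (f : chain_map X Y) : cm_comp h (cm_comp g f) = cm_comp (cm_comp h g) f.
Proof. by apply: chain_map_eq => i; rewrite /= mcompA. Qed.

Definition complexes : category := Category cm_comp1m cm_compm1 cm_compA.

Lemma cshift_subproof X i : (- diff X (i + 1 + 1)) · (- diff X (i + 1)) = 0.
Proof. by rewrite mcompNm mcompmN opprK diffK. Qed.

Definition cshift X : complex A :=
  @Complex A (fun i => X (i + 1)) (fun i => - diff X (i + 1)) (cshift_subproof X).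

Lemma cshift_map_subproof X Y (f : chain_map X Y) i :
  diff (cshift Y) i · f (i + 1) = f (i + 1 + 1) · diff (cshift X) i.
Proof. by rewrite /= mcompNm mcompmN cmapE. Qed.

Definition cshift_map X Y (f : chain_map X Y) :
  chain_map (cshift X) (cshift Y) :=
  @ChainMap (cshift X) (cshift Y) (fun i => f (i + 1)) (cshift_map_subproof f).

Lemma cshift_map_id X : cshift_map (cm_id X) = cm_id (cshift X).
Proof. exact: chain_map_eq. Qed.

Lemma cshift_map_comp X Y Z (g : chain_map Y Z) (f : chain_map X Y) :
  cshift_map (cm_comp g f) = cm_comp (cshift_map g) (cshift_map f).
Proof. exact: chain_map_eq. Qed.

Definition cshift_functor : functor complexes complexes :=
  @Functor complexes complexes cshift cshift_map cshift_map_id cshift_map_comp.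

Definition bounded_below X : Prop :=
  exists n : int, forall i : int, (i < n)%R -> is_zero (X i).

Definition bounded_above X : Prop :=
  exists n : int, forall i : int, (n < i)%R -> is_zero (X i).

End Complexes.

(* The index of C^*, D^*: empty, +, -, b. *)
Inductive boundedness := Unbounded | BoundedBelow | BoundedAbove | Bounded.

Definition has_bound (b : boundedness) (A : preadditive_category)
    (X : complex A) : Prop :=
  match b with
  | Unbounded => True
  | BoundedBelow => bounded_below X
  | BoundedAbove => bounded_above X
  | Bounded => bounded_below X /\ bounded_above X
  end.

(* Membership in C^b(P), for the full subcategory of [A] on the class [P]. *)
Definition complex_over (b : boundedness) (A : preadditive_category)
    (P : A -> Prop) (X : complex A) : Prop :=
  has_bound b X /\ forall i, P (X i).

Definition bounded_complexes (b : boundedness) (A : preadditive_category) :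
  category := @full_subcategory (complexes A) (@has_bound b A).

Section MappingCone.
Variables (A : additive_category) (X Y : complex A) (f : chain_map X Y).

Definition cone_ob (i : int) : A := biprod (X (i + 1)) (Y i).

Definition cone_diff (i : int) : mor (cone_ob i) (cone_ob (i + 1)) :=
  inl_ _ _ · (- diff X (i + 1)) · prl_ _ _
  + inr_ _ _ · (f (i + 1) · prl_ _ _ + diff Y i · prr_ _ _).

Lemma cone_diff_prl i : prl_ _ _ · cone_diff i = - diff X (i + 1) · prl_ _ _.
Proof.
by rewrite /cone_diff /cone_ob mcompDr !mcompA prl_inl mcomp1m prl_inr !mcomp0m addr0.
Qed.

Lemma cone_diff_prr i :
  prr_ _ _ · cone_diff i = f (i + 1) · prl_ _ _ + diff Y i · prr_ _ _.
Proof.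
by rewrite /cone_diff /cone_ob mcompDr !mcompA prr_inl prr_inr mcomp1m !mcomp0m add0r.
Qed.

Lemma cone_diff_inr i : cone_diff i · inr_ _ _ = inr_ _ _ · diff Y i.
Proof.
rewrite /cone_diff /cone_ob mcompDl -!mcompA prl_inr !mcompm0 add0r.
by rewrite mcompDl -!mcompA prl_inr prr_inr mcompm0 mcompm1 add0r.
Qed.

Lemma cone_diffK i : cone_diff (i + 1) · cone_diff i = 0.
Proof.
have l0 : prl_ _ _ · (cone_diff (i + 1) · cone_diff i) = 0.
  rewrite mcompA cone_diff_prl -mcompA cone_diff_prl mcompA.
  by rewrite mcompNm mcompmN opprK diffK mcomp0m.
have r0 : prr_ _ _ · (cone_diff (i + 1) · cone_diff i) = 0.
  rewrite mcompA cone_diff_prr mcompDl -!mcompA cone_diff_prl cone_diff_prr.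
  rewrite mcompDr !mcompA diffK mcomp0m addr0 cmapE -mcompDl.
  by rewrite mcompmN addNr mcomp0m.
by rewrite -[LHS]mcomp1m -biprod_id mcompDl -!mcompA l0 r0 !mcompm0 addr0.
Qed.

Definition cone : complex A := Complex cone_diffK.

Lemma cone_in_subproof i : diff cone i · inr_ _ _ = inr_ _ _ · diff Y i.
Proof. exact: cone_diff_inr. Qed.

Definition cone_in : chain_map Y cone :=
  @ChainMap _ Y cone (fun i => inr_ (X (i + 1)) (Y i)) cone_in_subproof.

Lemma cone_out_subproof i :
  diff (cshift X) i · prl_ _ _ = prl_ _ _ · diff cone i.
Proof. by rewrite /= cone_diff_prl. Qed.

Definition cone_out : chain_map cone (cshift X) :=
  @ChainMap _ cone (cshift X) (fun i => prl_ (X (i + 1)) (Y i))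
    cone_out_subproof.

End MappingCone.

Lemma is_zero_biprod (A : additive_category) (X Y : A) :
  is_zero X -> is_zero Y -> is_zero (biprod X Y).
Proof.
move=> [X0 X0'] [Y0 Y0']; split=> Z f.
  rewrite -[f]mcompm1 -biprod_id mcompDr !mcompA.
  by rewrite [f · inl_ _ _]X0 [f · inr_ _ _]Y0 !mcomp0m addr0.
rewrite -[f]mcomp1m -biprod_id mcompDl -!mcompA.
by rewrite [prl_ _ _ · f]X0' [prr_ _ _ · f]Y0' !mcompm0 addr0.
Qed.

Lemma has_bound_cshift b (A : preadditive_category) (X : complex A) :
  has_bound b X -> has_bound b (cshift X).
Proof.
have lo : bounded_below X -> bounded_below (cshift X).
  by move=> [n Xn]; exists (n - 1) => i; rewrite ltrBrDr => /Xn.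
have hi : bounded_above X -> bounded_above (cshift X).
  by move=> [n Xn]; exists (n - 1) => i; rewrite ltrBlDr => /Xn.
by case: b => //= [[/lo Xl /hi Xh]].
Qed.

Lemma has_bound_cone b (A : additive_category) (X Y : complex A)
    (f : chain_map X Y) : has_bound b X -> has_bound b Y -> has_bound b (cone f).
Proof.
have lo : bounded_below X -> bounded_below Y -> bounded_below (cone f).
  move=> [n Xn] [m Ym]; exists (Order.min (n - 1) m) => i.
  by rewrite lt_min ltrBrDr => /andP[/Xn Xi /Ym Yi]; exact: is_zero_biprod.
have hi : bounded_above X -> bounded_above Y -> bounded_above (cone f).
  move=> [n Xn] [m Ym]; exists (Order.max (n - 1) m) => i.
  by rewrite gt_max ltrBlDr => /andP[/Xn Xi /Ym Yi]; exact: is_zero_biprod.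
by case: b => //= [[Xl Xh]] [Yl Yh]; split; [exact: lo | exact: hi].
Qed.

(* With the differential leaving degree [i] valued in degree [i + 1], it is
   convenient to attach to [i] the cohomology in degree [i + 1]; as [i] ranges
   over the integers, all degrees are covered. *)

Section Cohomology.
Variable A : abelian_category.
Implicit Types X Y : complex A.

Definition cocycles X i : A := ker (diff X (i + 1)).

Definition boundary X i : mor (X i) (cocycles X i) := ker_lift (diffK X i).

Definition cohomology X i : A := coker (boundary X i).

Section InducedMap.
Variables (X Y : complex A) (f : chain_map X Y) (i : int).

Lemma cocycles_map_subproof :
  diff Y (i + 1) · (f (i + 1) · ker_i (diff X (i + 1))) = 0.
Proof. by rewrite mcompA cmapE -mcompA (ker_iP _).1 mcompm0. Qed.

Definition cocycles_map : mor (cocycles X i) (cocycles Y i) :=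
  ker_lift cocycles_map_subproof.

Lemma cohomology_map_subproof :
  coker_p (boundary Y i) · cocycles_map · boundary X i = 0.
Proof.
have -> : coker_p (boundary Y i) · cocycles_map · boundary X i =
    coker_p (boundary Y i) · (boundary Y i · f i).
  rewrite -mcompA; congr (_ · _); apply: ker_i_mono.
  by rewrite mcompA ker_liftK -mcompA ker_liftK mcompA ker_liftK cmapE.
by rewrite mcompA (coker_pP _).1 mcomp0m.
Qed.

Definition cohomology_map : mor (cohomology X i) (cohomology Y i) :=
  coker_desc cohomology_map_subproof.

End InducedMap.

Definition quasi_iso X Y (f : chain_map X Y) : Prop :=
  forall i, isomorphism (cohomology_map f i).

Section Shift.
Variables (X : complex A) (i : int).

Local Notation sX := (cshift X).

Lemma cocycles_shift_subproof :
  diff X (i + 1 + 1) · ker_i (diff sX (i + 1)) = 0.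
Proof.
by apply: oppr_inj; rewrite -mcompNm oppr0; exact: (ker_iP (diff sX (i + 1))).1.
Qed.

Definition cocycles_shift : mor (cocycles sX i) (cocycles X (i + 1)) :=
  ker_lift cocycles_shift_subproof.

Lemma cocycles_unshift_subproof :
  diff sX (i + 1) · ker_i (diff X (i + 1 + 1)) = 0.
Proof. by rewrite /= mcompNm (ker_iP _).1 oppr0. Qed.

Definition cocycles_unshift : mor (cocycles X (i + 1)) (cocycles sX i) :=
  ker_lift cocycles_unshift_subproof.

Lemma cocycles_shiftK : cocycles_unshift · cocycles_shift = mid _.
Proof.
by apply: ker_i_mono; rewrite mcompA ker_liftK ker_liftK mcompm1.
Qed.

Lemma cocycles_unshiftK : cocycles_shift · cocycles_unshift = mid _.
Proof.
by apply: ker_i_mono; rewrite mcompA ker_liftK ker_liftK mcompm1.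
Qed.

Lemma cocycles_shift_boundary :
  cocycles_shift · boundary sX i = - boundary X (i + 1).
Proof. by apply: ker_i_mono; rewrite mcompA mcompmN !ker_liftK. Qed.

Lemma cocycles_unshift_boundary :
  cocycles_unshift · boundary X (i + 1) = - boundary sX i.
Proof.
apply: oppr_inj; rewrite opprK -mcompmN -cocycles_shift_boundary mcompA.
by rewrite cocycles_shiftK mcomp1m.
Qed.

Lemma cohomology_shift_subproof :
  coker_p (boundary X (i + 1)) · cocycles_shift · boundary sX i = 0.
Proof.
by rewrite -mcompA cocycles_shift_boundary mcompmN (coker_pP _).1 oppr0.
Qed.

Definition cohomology_shift : mor (cohomology sX i) (cohomology X (i + 1)) :=
  coker_desc cohomology_shift_subproof.

Lemma cohomology_unshift_subproof :
  coker_p (boundary sX i) · cocycles_unshift · boundary X (i + 1) = 0.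
Proof.
by rewrite -mcompA cocycles_unshift_boundary mcompmN (coker_pP _).1 oppr0.
Qed.

Definition cohomology_unshift : mor (cohomology X (i + 1)) (cohomology sX i) :=
  coker_desc cohomology_unshift_subproof.

Lemma cohomology_shiftK : cohomology_unshift · cohomology_shift = mid _.
Proof.
apply: coker_p_epi; rewrite -mcompA coker_descK mcompA coker_descK -mcompA.
by rewrite cocycles_shiftK mcompm1 mcomp1m.
Qed.

Lemma cohomology_unshiftK : cohomology_shift · cohomology_unshift = mid _.
Proof.
apply: coker_p_epi; rewrite -mcompA coker_descK mcompA coker_descK -mcompA.
by rewrite cocycles_unshiftK mcompm1 mcomp1m.
Qed.

End Shift.

Lemma cohomology_shift_natural X Y (f : chain_map X Y) i :
  cohomology_shift Y i · cohomology_map (cshift_map f) i =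
  cohomology_map f (i + 1) · cohomology_shift X i.
Proof.
apply: coker_p_epi; rewrite -!mcompA !coker_descK !mcompA !coker_descK -!mcompA.
congr (_ · _); apply: ker_i_mono.
by rewrite !mcompA !ker_liftK -mcompA ker_liftK.
Qed.

Lemma quasi_iso_cshift X Y (f : chain_map X Y) :
  quasi_iso f -> quasi_iso (cshift_map f).
Proof.
move=> qf i; have [g /= [gf fg]] := qf (i + 1).
have E : cohomology_map (cshift_map f) i =
    cohomology_unshift Y i · cohomology_map f (i + 1) · cohomology_shift X i.
  by rewrite -mcompA -cohomology_shift_natural mcompA cohomology_shiftK mcomp1m.
exists (cohomology_unshift X i · g · cohomology_shift Y i) => /=; split.
- rewrite E -!mcompA (mcompA (cohomology_shift Y i)) cohomology_unshiftK mcomp1m.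
  by rewrite (mcompA g) gf mcomp1m cohomology_shiftK.
- rewrite E -!mcompA (mcompA (cohomology_shift X i)) cohomology_unshiftK mcomp1m.
  by rewrite (mcompA (cohomology_map f (i + 1))) fg mcomp1m cohomology_shiftK.
Qed.

End Cohomology.

Section DerivedCategory.
Variables (b : boundedness) (A : abelian_category).

Local Notation CA := (bounded_complexes b A).

Definition bounded_quasi_iso (X Y : CA) (f : hom X Y) : Prop :=
  @quasi_iso A (sval X) (sval Y) f.

Definition bounded_shift : functor CA CA :=
  @functor_restr (complexes A) (@has_bound b A) (cshift_functor A)
    (@has_bound_cshift b A).

Lemma bounded_shift_quasi_iso (X Y : CA) (s : hom X Y) :
  bounded_quasi_iso s -> bounded_quasi_iso (fhom bounded_shift s).
Proof. exact: quasi_iso_cshift. Qed.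

Definition derived_cat : category := localization bounded_quasi_iso.

Definition derived_shift : functor derived_cat derived_cat :=
  loc_functor bounded_shift_quasi_iso.

Definition bounded_cone (X Y : CA) (u : hom X Y) : CA :=
  exist (@has_bound b A) (@cone A (sval X) (sval Y) u)
    (has_bound_cone u (svalP X) (svalP Y)).

Definition derived_exact (X Y Z : derived_cat)
    (f : hom X Y) (g : hom Y Z) (h : hom Z (derived_shift X)) : Prop :=
  exists (U V : CA) (u : hom U V),
    @triangle_iso derived_cat derived_shift
      X Y Z f g h
      U V (bounded_cone u)
      (loc_map bounded_quasi_iso u)
      (@loc_map CA bounded_quasi_iso V (bounded_cone u) (cone_in u))
      (@loc_map CA bounded_quasi_iso (bounded_cone u) (bounded_shift U)
         (cone_out u)).

Definition derived : triangle_category :=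
  @TriangleCategory derived_cat derived_shift derived_exact.

Definition complex_of (X : derived) : complex A := sval (X : CA).

End DerivedCategory.

Section Resolutions.
Variable A : abelian_category.

(* [b] is [BoundedAbove] for projective resolutions, [BoundedBelow] for
   injective co-resolutions, and [Bounded] for finite ones. *)
Definition has_resolution (b : boundedness) (P : A -> Prop) (Z : complex A) :
    Prop :=
  exists (Q : complex A) (q : chain_map Q Z), complex_over b P Q /\ quasi_iso q.

Definition has_coresolution (b : boundedness) (P : A -> Prop) (X : complex A) :
    Prop :=
  exists (I : complex A) (j : chain_map X I), complex_over b P I /\ quasi_iso j.

End Resolutions.

(* Main.v *)
(** Let $P \to Z$ be a projective resolution and $P' \subseteq P$ its brutal
    truncation in degrees $\ge n$, which is a finite complex.  If the composite
    $P' \to Z$ is not a retraction in the derived category, it factors through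
    $Y$, so its composite with $h : Z \to X[1]$ vanishes; as $X[1]$ is bounded
    below, for $n$ small enough a null-homotopy on $P'$ extends by zero to $P$,
    whence $h = 0$ on $P$ and $Y \to Z$ is a retraction, a contradiction.
    A section of $P' \to Z$ then gives $P \to P' \to P$ homotopic to the
    identity, so $P$ is contractible in low degrees and splits off a finite
    complex homotopy equivalent to it.  The second part is dual, with $X \to Y$
    tested against the brutal quotients of an injective co-resolution.

    Morphisms of the derived category are only met through their action on
    homotopy classes of maps from a complex of projectives (or to a complex of
    injectives), on which quasi-isomorphisms act bijectively; no calculus of
    fractions is needed.  Truncated complexes are kernels of idempotents, or of
    maps depending on the degree by a case distinction, so that no object is
    defined by cases on the degree. *)

From mathcomp Require Import all_boot all_order all_algebra.
From mathcomp Require Import boolp.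
Require Import Defs.

Set Implicit Arguments.
Unset Strict Implicit.
Unset Printing Implicit Defensive.

Import Order.TTheory GRing.Theory Num.Theory.
Local Open Scope ring_scope.

(** * Generalized elements in abelian categories *)

Lemma addrACK (V : zmodType) (x y : V) : x + y - x = y.
Proof. by rewrite addrAC subrr add0r. Qed.

Section Preadditive.
Variable A : preadditive_category.
Implicit Types X Y Z W : A.

Lemma mcompBl X Y Z (g g' : mor Y Z) (f : mor X Y) :
  (g - g') · f = g · f - g' · f.
Proof. by rewrite mcompDl mcompNm. Qed.

Lemma mcompBr X Y Z (g : mor Y Z) (f f' : mor X Y) :
  g · (f - f') = g · f - g · f'.
Proof. by rewrite mcompDr mcompmN. Qed.

Lemma epi0 X Y (f : mor X Y) :
  (forall W (u : mor Y W), u · f = 0 -> u = 0) -> epi f.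
Proof.
move=> f0 W u v uv; apply: subr0_eq; apply: f0.
by rewrite mcompBl uv subrr.
Qed.

Lemma mono0 X Y (f : mor X Y) :
  (forall W (u : mor W X), f · u = 0 -> u = 0) -> mono f.
Proof.
move=> f0 W u v uv; apply: subr0_eq; apply: f0.
by rewrite mcompBr uv subrr.
Qed.

Lemma epi_eq0 X Y (f : mor X Y) W (u : mor Y W) : epi f -> u · f = 0 -> u = 0.
Proof. by move=> ef uf; apply: ef; rewrite uf mcomp0m. Qed.

Lemma epi_mid X : epi (mid X).
Proof. by move=> W u v; rewrite !mcompm1. Qed.

Lemma epi_comp X Y Z (g : mor Y Z) (f : mor X Y) : epi g -> epi f -> epi (g · f).
Proof. by move=> eg ef W u v; rewrite !mcompA => /ef/eg. Qed.

Lemma mono_comp X Y Z (g : mor Y Z) (f : mor X Y) :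
  mono g -> mono f -> mono (g · f).
Proof. by move=> mg mf W u v; rewrite -!mcompA => /mg/mf. Qed.

Lemma is_zero_retract X Y (r : mor X Y) (i : mor Y X) :
  r · i = mid Y -> is_zero X -> is_zero Y.
Proof.
move=> ri [X0 X0']; split=> W f.
  by rewrite -[f]mcompm1 -ri mcompA [f · r]X0 mcomp0m.
by rewrite -[f]mcomp1m -ri -mcompA [i · f]X0' mcompm0.
Qed.

Lemma is_zero_mid X : mid X = 0 -> is_zero X.
Proof.
by move=> e; split=> W f; [rewrite -[f]mcompm1|rewrite -[f]mcomp1m];
  rewrite e ?mcomp0m ?mcompm0.
Qed.

Lemma isomorphism_2of3l X Y Z (g : mor Y Z) (f : mor X Y) :
  isomorphism f -> isomorphism (g · f) -> isomorphism g.
Proof.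
move=> [f' /= [f'f ff']] [k /= [kgf gfk]]; exists (f · k) => /=; split.
  by rewrite -[LHS]mcompm1 -ff' !mcompA -(mcompA _ g f) -(mcompA f) kgf mcompm1.
by rewrite mcompA.
Qed.

Lemma isomorphism_2of3r X Y Z (g : mor Y Z) (f : mor X Y) :
  isomorphism g -> isomorphism (g · f) -> isomorphism f.
Proof.
move=> [g' /= [g'g gg']] [k /= [kgf gfk]]; exists (k · g) => /=; split.
  by rewrite -mcompA.
by rewrite -[LHS]mcomp1m -g'g -!mcompA (mcompA f) (mcompA g) (mcompA g) gfk mcomp1m.
Qed.

Lemma isomorphism_comp X Y Z (g : mor Y Z) (f : mor X Y) :
  isomorphism g -> isomorphism f -> isomorphism (g · f).
Proof.
move=> [g' /= [g'g gg']] [f' /= [f'f ff']]; exists (f' · g') => /=; split.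
  by rewrite -mcompA (mcompA g') g'g mcomp1m.
by rewrite -mcompA (mcompA f) ff' mcomp1m.
Qed.

End Preadditive.

Section Abelian.
Variable A : abelian_category.
Implicit Types X Y Z W : A.

Lemma biprod_ext X Y W (u v : mor W (biprod X Y)) :
  prl_ X Y · u = prl_ X Y · v -> prr_ X Y · u = prr_ X Y · v -> u = v.
Proof.
move=> l r; rewrite -[u]mcomp1m -[v]mcomp1m -biprod_id !mcompDl -!mcompA.
by rewrite l r.
Qed.

Lemma biprod_coext X Y W (u v : mor (biprod X Y) W) :
  u · inl_ X Y = v · inl_ X Y -> u · inr_ X Y = v · inr_ X Y -> u = v.
Proof.
move=> l r; rewrite -[u]mcompm1 -[v]mcompm1 -biprod_id !mcompDr !mcompA.
by rewrite l r.
Qed.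

Definition mpair X Y W (a : mor W X) (b : mor W Y) : mor W (biprod X Y) :=
  inl_ X Y · a + inr_ X Y · b.

Lemma prl_mpair X Y W (a : mor W X) (b : mor W Y) : prl_ X Y · mpair a b = a.
Proof. by rewrite mcompDr !mcompA prl_inl prl_inr mcomp1m mcomp0m addr0. Qed.

Lemma prr_mpair X Y W (a : mor W X) (b : mor W Y) : prr_ X Y · mpair a b = b.
Proof. by rewrite mcompDr !mcompA prr_inl prr_inr mcomp1m mcomp0m add0r. Qed.

Definition mcopair X Y W (a : mor X W) (b : mor Y W) : mor (biprod X Y) W :=
  a · prl_ X Y + b · prr_ X Y.

Lemma mcopair_inl X Y W (a : mor X W) (b : mor Y W) : mcopair a b · inl_ X Y = a.
Proof. by rewrite mcompDl -!mcompA prl_inl prr_inl mcompm1 mcompm0 addr0. Qed.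

Lemma mcopair_inr X Y W (a : mor X W) (b : mor Y W) : mcopair a b · inr_ X Y = b.
Proof. by rewrite mcompDl -!mcompA prl_inr prr_inr mcompm1 mcompm0 add0r. Qed.

Lemma ker_factor X Y (f : mor X Y) W (u : mor W X) :
  f · u = 0 -> exists v, ker_i f · v = u.
Proof. by move=> e; exists (ker_lift e); rewrite ker_liftK. Qed.

Lemma coker_factor X Y (f : mor X Y) W (u : mor Y W) :
  u · f = 0 -> exists v, v · coker_p f = u.
Proof. by move=> e; exists (coker_desc e); rewrite coker_descK. Qed.

(** If [w] kills [e], the kernel of [w], seen as a subobject of [Y], is the kernel of some [r]. Then
    [r] kills [f], so it factors through the cokernel of [f] and kills the whole image; hence the
    image lies in the kernel of [w], and [w = 0]. *)
Lemma image_epi X Y (f : mor X Y) (e : mor X (ker (coker_p f))) :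
  ker_i (coker_p f) · e = f -> epi e.
Proof.
move=> ef; apply: epi0 => W w we0.
have [e' kE] := ker_factor we0.
have [Z [r [r0 rP]]] := mono_normal (mono_comp (@ker_i_mono A _ _ (coker_p f))
  (@ker_i_mono A _ _ w)).
have rf : r · f = 0 by rewrite -ef -kE !mcompA -(mcompA r) r0 mcomp0m.
have [r' rE] := coker_factor rf.
have [|j [jE _]] := rP _ (ker_i (coker_p f)).
  by rewrite -rE -mcompA (ker_iP _).1 mcompm0.
have {}jE : ker_i w · j = mid _.
  by apply: (@ker_i_mono _ _ _ (coker_p f)); rewrite mcompA jE mcompm1.
by rewrite -[w]mcompm1 -jE mcompA (ker_iP _).1 mcomp0m.
Qed.

Lemma coimage_mono X Y (f : mor X Y) (m : mor (coker (ker_i f)) Y) :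
  m · coker_p (ker_i f) = f -> mono m.
Proof.
move=> mf; apply: mono0 => W w mw0.
have [m' kE] := coker_factor mw0.
have [Z [r [r0 rP]]] := epi_conormal (epi_comp (@coker_p_epi A _ _ w)
  (@coker_p_epi A _ _ (ker_i f))).
have fr : f · r = 0 by rewrite -mf -kE -!mcompA (mcompA _ _ r) r0 mcompm0.
have [r' rE] := ker_factor fr.
have [|j [jE _]] := rP _ (coker_p (ker_i f)).
  by rewrite -rE mcompA (coker_pP _).1 mcomp0m.
have {}jE : j · coker_p w = mid _.
  by apply: (@coker_p_epi _ _ _ (ker_i f)); rewrite -mcompA jE mcomp1m.
by rewrite -[w]mcomp1m -jE -mcompA (coker_pP _).1 mcompm0.
Qed.

Lemma mono_epi_iso X Y (f : mor X Y) : mono f -> epi f -> isomorphism f.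
Proof.
move=> mf ef; have [Z [g [gf0 gP]]] := mono_normal mf.
have g0 := epi_eq0 ef gf0.
have [|v [fv _]] := gP _ (mid Y); first by rewrite g0 mcomp0m.
exists v => /=; split=> //.
by apply: mf; rewrite mcompA fv mcomp1m mcompm1.
Qed.

(** The pullback is the kernel of [phi = (e, -u)] on the biproduct. If [w] dies on it, [w · prr_]
    factors through the epimorphism [phi]; the factor is zero because it vanishes after [e], the
    restriction of [phi] to [X]. *)
Lemma pullback_epi X Y W (e : mor X Y) (u : mor W Y) : epi e ->
  exists W' (c : mor W' W) (t : mor W' X), epi c /\ e · t = u · c.
Proof.
move=> ee; pose phi := e · prl_ X W - u · prr_ X W.
have phil : phi · inl_ X W = e.
  by rewrite mcompBl -!mcompA prl_inl prr_inl mcompm0 mcompm1 subr0.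
have ephi : epi phi.
  by apply: epi0 => M w w0; apply: (epi_eq0 ee); rewrite -phil mcompA w0 mcomp0m.
have [Z [z [pz0 zP]]] := epi_conormal ephi.
have [z' zE] := ker_factor pz0.
exists (ker phi), (prr_ X W · ker_i phi), (prl_ X W · ker_i phi); split.
  apply: epi0 => M w; rewrite mcompA => w0.
  have [|w' [w'E _]] := zP _ (w · prr_ X W).
    by rewrite -zE mcompA w0 mcomp0m.
  have w'0 : w' = 0.
    by apply: (epi_eq0 ee); rewrite -phil mcompA w'E -mcompA prr_inl mcompm0.
  by rewrite -[w]mcompm1 -(prr_inr X W) mcompA -w'E w'0 !mcomp0m.
apply: subr0_eq; rewrite !mcompA -mcompBl; exact: (ker_iP phi).1.
Qed.

Lemma coker_exact X Y (f : mor X Y) W (u : mor W Y) : coker_p f · u = 0 ->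
  exists W' (c : mor W' W) (t : mor W' X), epi c /\ f · t = u · c.
Proof.
move=> /ker_factor[v vE]; have [e eE] := ker_factor (coker_pP f).1.
have [W' [c [t [ec ct]]]] := pullback_epi v (image_epi eE).
by exists W', c, t; split=> //; rewrite -eE -mcompA ct mcompA vE.
Qed.

(* Exactness is tested on generalized elements of the middle object, which are
   lifted after refining their domain along an epimorphism. *)
Definition exact_at X Y Z (f : mor X Y) (g : mor Y Z) : Prop :=
  forall W (y : mor W Y), g · y = 0 ->
    exists W' (c : mor W' W) (t : mor W' X), epi c /\ f · t = y · c.

Lemma exact_projective X Y Z (f : mor X Y) (g : mor Y Z) W (y : mor W Y) :
  exact_at f g -> projective W -> g · y = 0 -> exists t, f · t = y.
Proof.
move=> fg pW /fg[W' [c [t [ec tE]]]]; have [s sE] := pW _ _ c (mid W) ec.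
by exists (t · s); rewrite mcompA tE -mcompA sE mcompm1.
Qed.

(** Exactness makes [y] vanish on the kernel of [g], so [y] descends to the coimage, which embeds in
    [Z]; injectivity extends it from there. *)
Lemma exact_injective X Y Z (f : mor X Y) (g : mor Y Z) W (y : mor Y W) :
  exact_at f g -> injective_object W -> y · f = 0 -> exists t, t · g = y.
Proof.
move=> fg iW yf; have [W' [c [t [ec tE]]]] := fg _ _ (ker_iP g).1.
have yk : y · ker_i g = 0.
  by apply: (epi_eq0 ec); rewrite -mcompA -tE mcompA yf mcomp0m.
have [y' y'E] := coker_factor yk; have [m mE] := coker_factor (ker_iP g).1.
have [s sE] := iW _ _ m y' (coimage_mono mE).
by exists s; rewrite -mE mcompA sE.
Qed.

(** The retraction splits [X] as the biproduct of [Y] and [ker r], so closure under isomorphisms and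
    summands applies. *)
Lemma strictly_additive_retract (P : A -> Prop) X Y (r : mor X Y) (i : mor Y X) :
  strictly_additive P -> r · i = mid Y -> P X -> P Y.
Proof.
move=> [_ _ Pbi Piso] ri PX.
have r0 : r · (mid X - i · r) = 0.
  by rewrite mcompBr mcompm1 mcompA ri mcomp1m subrr.
have [k kE] := ker_factor r0.
suff /(Piso X)/(_ PX)/Pbi[] : isomorphic X (biprod Y (ker r)) by [].
exists (inl_ _ _ · r + inr_ _ _ · k).
exists (i · prl_ _ _ + ker_i r · prr_ _ _) => /=; split.
  rewrite !mcompDl !mcompDr -!mcompA (mcompA (prl_ _ _)) (mcompA (prr_ _ _)).
  rewrite (mcompA (prl_ _ _)) (mcompA (prr_ _ _)) prl_inl prr_inl prl_inr prr_inr.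
  by rewrite !mcomp0m !mcomp1m !mcompm0 addr0 add0r kE addrC subrK.
have ki0 : k · i = 0.
  apply: (@ker_i_mono _ _ _ r).
  by rewrite mcompA kE mcompBl -mcompA ri mcompm1 mcomp1m subrr mcompm0.
have kk : k · ker_i r = mid _.
  apply: (@ker_i_mono _ _ _ r).
  by rewrite mcompA kE mcompBl -mcompA (ker_iP r).1 mcompm0 mcompm1 mcomp1m subr0.
rewrite !mcompDl !mcompDr -!mcompA (mcompA r) (mcompA r) (mcompA k) (mcompA k).
by rewrite ri ki0 kk (ker_iP r).1 !mcomp1m !mcomp0m !mcompm0 addr0 add0r biprod_id.
Qed.

End Abelian.

(** * Families indexed by the integers *)

Section IntegerFamilies.
Variable T : int -> Type.

Lemma int_succP (Q : int -> Prop) : (forall i, Q (i + 1)) -> forall i, Q i.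
Proof. by move=> Q1 i; rewrite -[i](subrK 1). Qed.

Lemma family_choice (Q : forall i, T i -> Prop) :
  (forall i, exists t, Q i t) -> exists G : forall i, T i, forall i, Q i (G i).
Proof. by move=> ex; exists (fun i => sval (cid (ex i))) => i; case: cid. Qed.

(** [T i] and [T (i - 1 + 1)] are not convertible, so the value is pinned down as the transport of
    [g j] along every proof of [j + 1 = i]. Uniqueness of equality proofs on the integers makes the
    transport trivial at a successor. *)
Lemma unshift_family (g : forall i, T (i + 1)) :
  exists G : forall i, T i, forall i, G (i + 1) = g i.
Proof.
have /family_choice[G GP] i :
    exists t : T i, forall j (e : j + 1 = i), ecast i (T i) e (g j) = t.
  move: i; apply: int_succP => i; exists (g i) => j e.
  have ji : j = i by apply: (addIr 1).
  by subst j; rewrite (eq_axiomK e).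
by exists G => i; rewrite -(GP (i + 1) i erefl).
Qed.

Lemma update_family (G : forall i, T i) j (t : T j) :
  exists G' : forall i, T i, G' j = t /\ forall i, i != j -> G' i = G i.
Proof.
have /family_choice[G' G'P] i : exists s : T i,
    (forall e : j = i, ecast i (T i) e t = s) /\ (i != j -> s = G i).
  have [->|ij] := eqVneq i j.
    by exists t; split=> // e; rewrite (eq_axiomK e).
  by exists (G i); split=> // e; rewrite e eqxx in ij.
exists G'; split; first by rewrite -((G'P j).1 erefl).
by move=> i; exact: (G'P i).2.
Qed.

(* [D k] is the set of degrees in which the [k]-th approximation is final. *)
Lemma glue_families (D : nat -> int -> bool) (ok : nat -> (forall i, T i) -> Prop)
    (G0 : forall i, T i) :
  (forall i, exists k, D k i) -> (forall k i, D k i -> D k.+1 i) -> ok 0%N G0 ->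
  (forall k G, ok k G ->
    exists G', ok k.+1 G' /\ forall i, D k i -> G' i = G i) ->
  exists G, forall k, exists F, ok k F /\ forall i, D k i -> G i = F i.
Proof.
move=> exD DS ok0 next.
pose nxt k (G : {G | ok k G}) : {G | ok k.+1 G} :=
  let: exist G' P := cid (next k _ (svalP G)) in exist _ G' P.1.
pose fix F k : {G | ok k G} :=
  if k is k'.+1 then nxt _ (F k') else exist _ G0 ok0.
have FS k i : D k i -> sval (F k.+1) i = sval (F k) i.
  by move=> Dki /=; rewrite /nxt; case: cid => G' /= [_ ->].
have FD k n i : D k i -> D (n + k)%N i /\ sval (F (n + k)%N) i = sval (F k) i.
  move=> Dki; elim: n => //= n [Dnk <-]; split; first exact: DS.
  exact: FS.
pose K i := sval (cid (exD i)); have DK i : D (K i) i by rewrite /K; case: cid.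
exists (fun i => sval (F (K i)) i) => k; exists (sval (F k)).
split; first exact: svalP (F k).
move=> i Dki; have [/subnK <-|/ltnW/subnK e] := leqP (K i) k.
  by rewrite (FD _ _ _ (DK i)).2.
by rewrite -e (FD _ _ _ Dki).2.
Qed.

Variable R : forall i, T i -> T (i + 1) -> Prop.

(** The [k]-th approximation satisfies [R] from degree [n - k] on; [step] supplies a value one
    degree lower, and values already final are kept. *)
Lemma descending_family (n : int) (G0 : forall i, T i) :
  (forall i, n <= i -> R (G0 i) (G0 (i + 1))) ->
  (forall i (t1 : T (i + 1)) (t2 : T (i + 1 + 1)), R t1 t2 ->
     exists t : T i, R t t1) ->
  exists G : forall i, T i, forall i, R (G i) (G (i + 1)).
Proof.
move=> R0 step.
pose D k i := n - k%:Z <= i.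
pose ok k (G : forall i, T i) := forall i, D k i -> R (G i) (G (i + 1)).
have DS k i : D k i -> D k (i + 1).
  by rewrite /D => h; apply: (le_trans h); rewrite lerDl.
have exD i : exists k, D k i.
  by exists `|n - i|%N; rewrite /D lerBlDr -lerBlDl abszE ler_norm.
have [||k G okG|G GP] := @glue_families D ok G0 exD.
- by move=> k i; apply: le_trans; rewrite lerD2l lerN2 lez_nat.
- by move=> i; rewrite /D subr0; exact: R0.
- pose j := n - k.+1%:Z.
  have jE : j + 1 = n - k%:Z.
    by rewrite /j -addn1 PoszD opprD addrA subrK.
  have [|t tR] := step j (G (j + 1)) (G (j + 1 + 1)).
    by apply: okG; rewrite /D -jE.
  have [G' [G'j G'i]] := update_family G t.
  have agree i : D k i -> G' i = G i.
    by rewrite /D -jE lezD1 => ji; apply: G'i; rewrite gt_eqF.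
  exists G'; split=> // i; rewrite /D -/j le_eqVlt => /predU1P[<-|ji].
    by rewrite G'j agree // /D jE.
  have ki : D k i by rewrite /D -jE lezD1.
  by rewrite !agree //; [exact: okG|exact: DS].
- exists G => i; have [k Dki] := exD i; have [F [okF GF]] := GP k.
  by rewrite !GF //; [exact: okF|exact: DS].
Qed.

Lemma ascending_family (n : int) (G0 : forall i, T i) :
  (forall i, i <= n -> R (G0 i) (G0 (i + 1))) ->
  (forall i (t0 : T i) (t1 : T (i + 1)), R t0 t1 ->
     exists t : T (i + 1 + 1), R t1 t) ->
  exists G : forall i, T i, forall i, R (G i) (G (i + 1)).
Proof.
move=> R0 step.
(* [R] at [i] also involves degree [i + 1], so the initial values are final up to [n + 1] rather
   than [n]. *)
pose D k i := i <= n + 1 + k%:Z.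
pose ok k (G : forall i, T i) := forall i, D k (i + 1) -> R (G i) (G (i + 1)).
have DS k i : D k (i + 1) -> D k i.
  by apply: le_trans; rewrite lerDl.
have exD i : exists k, D k i.
  by exists `|i - (n + 1)%R|%N; rewrite /D -lerBlDl abszE ler_norm.
have [||k G okG|G GP] := @glue_families D ok G0 exD.
- by move=> k i /le_trans; apply; rewrite lerD2l lez_nat.
- by move=> i; rewrite /D addr0 lerD2r; exact: R0.
- pose j := n + k%:Z.
  have jE : j + 1 = n + 1 + k%:Z by rewrite /j addrAC.
  have jE' : j + 1 + 1 = n + 1 + k.+1%:Z by rewrite jE -addrA -addn1.
  have [|t tR] := step j (G j) (G (j + 1)).
    by apply: okG; rewrite /D jE.
  have [G' [G'j G'i]] := update_family G t.
  have agree i : D k i -> G' i = G i.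
    by rewrite /D -jE -ltzD1 => ji; apply: G'i; rewrite lt_eqF.
  exists G'; split=> // i; rewrite /D -jE' le_eqVlt => /predU1P[/addIr->|].
    by rewrite G'j agree // /D jE.
  rewrite ltrD2r -lezD1 jE => ki.
  by rewrite !agree //; [exact/okG|exact: DS].
- exists G => i; have [k Dki] := exD (i + 1); have [F [okF GF]] := GP k.
  by rewrite !GF //; [exact: okF|exact: DS].
Qed.

End IntegerFamilies.

(** * Homotopies, cohomology and mapping cones *)

Section Homotopy.
Variable A : preadditive_category.
Implicit Types X Y Z : complex A.

Lemma cm_zero_subproof X Y i :
  diff Y i · (0 : mor (X i) (Y i)) = (0 : mor (X (i + 1)) (Y (i + 1))) · diff X i.
Proof. by rewrite mcompm0 mcomp0m. Qed.

Definition cm_zero X Y : chain_map X Y := ChainMap (@cm_zero_subproof X Y).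

(** Written in degree [i + 1], where all terms have matching types without transport; every degree
    has this form. *)
Definition homotopic X Y (f g : chain_map X Y) : Prop :=
  exists s : forall i, mor (X (i + 1)) (Y i),
    forall i, f (i + 1) - g (i + 1) = diff Y i · s i + s (i + 1) · diff X (i + 1).

Definition null_homotopic X Y (f : chain_map X Y) : Prop :=
  exists s : forall i, mor (X (i + 1)) (Y i),
    forall i, f (i + 1) = diff Y i · s i + s (i + 1) · diff X (i + 1).

Lemma homotopic0 X Y (f : chain_map X Y) :
  homotopic f (cm_zero X Y) <-> null_homotopic f.
Proof. by split=> [][s sE]; exists s => i; rewrite -sE subr0. Qed.

Lemma homotopic_refl X Y (f : chain_map X Y) : homotopic f f.
Proof. by exists (fun=> 0) => i; rewrite mcompm0 mcomp0m addr0 subrr. Qed.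

Lemma homotopic_sym X Y (f g : chain_map X Y) : homotopic f g -> homotopic g f.
Proof.
move=> [s sE]; exists (fun i => - s i) => i.
by rewrite mcompmN mcompNm -opprD -sE opprB.
Qed.

Lemma homotopic_trans X Y (f g h : chain_map X Y) :
  homotopic f g -> homotopic g h -> homotopic f h.
Proof.
move=> [s sE] [t tE]; exists (fun i => s i + t i) => i.
by rewrite mcompDl mcompDr addrACA -sE -tE addrA subrK.
Qed.

Lemma homotopic_compl X Y Z (h : chain_map Y Z) (f g : chain_map X Y) :
  homotopic f g -> homotopic (cm_comp h f) (cm_comp h g).
Proof.
move=> [s sE]; exists (fun i => h i · s i) => i /=.
by rewrite -mcompBr sE mcompDr !mcompA cmapE.
Qed.

Lemma homotopic_compr X Y Z (h : chain_map X Y) (f g : chain_map Y Z) :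
  homotopic f g -> homotopic (cm_comp f h) (cm_comp g h).
Proof.
move=> [s sE]; exists (fun i => s i · h (i + 1)) => i /=.
by rewrite -mcompBl sE mcompDl -!mcompA cmapE.
Qed.

Lemma homotopic_cshift X Y (f g : chain_map X Y) :
  homotopic f g -> homotopic (cshift_map f) (cshift_map g).
Proof.
move=> [s sE]; exists (fun i => - s (i + 1)) => i /=.
by rewrite !mcompmN !mcompNm !opprK sE.
Qed.

Lemma cm_comp0m X Y Z (f : chain_map X Y) : cm_comp (cm_zero Y Z) f = cm_zero X Z.
Proof. by apply: chain_map_eq => i /=; rewrite mcomp0m. Qed.

Lemma cm_compm0 X Y Z (g : chain_map Y Z) : cm_comp g (cm_zero X Y) = cm_zero X Z.
Proof. by apply: chain_map_eq => i /=; rewrite mcompm0. Qed.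

Lemma unshift_chain_map X Y (f : forall i, mor (X (i + 1)) (Y (i + 1))) :
  (forall i, diff Y (i + 1) · f i = f (i + 1) · diff X (i + 1)) ->
  exists F : chain_map X Y, forall i, F (i + 1) = f i.
Proof.
move=> fE; have [F FE] := unshift_family (T := fun i => mor (X i) (Y i)) f.
have FC : forall i, diff Y i · F i = F (i + 1) · diff X i.
  by apply: int_succP => i; rewrite !FE.
by exists (ChainMap FC).
Qed.

(** Any family of degree -1 can be used: [d s + s d] commutes with the differentials because
    [d d = 0]. *)
Lemma perturb_chain_map X Y (f : chain_map X Y)
    (s : forall i, mor (X (i + 1)) (Y i)) :
  exists F : chain_map X Y, homotopic f F /\
    forall i, F (i + 1) = f (i + 1) - (diff Y i · s i + s (i + 1) · diff X (i + 1)).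
Proof.
have [i|F FE] := @unshift_chain_map X Y (fun i =>
    f (i + 1) - (diff Y i · s i + s (i + 1) · diff X (i + 1))).
  rewrite mcompBr mcompBl cmapE mcompDr mcompDl !mcompA diffK mcomp0m add0r.
  by rewrite -(mcompA (s _)) diffK mcompm0 addr0.
by exists F; split=> //; exists s => i; rewrite FE opprB addrCA subrr addr0.
Qed.

Lemma is_zero_hom0 (U V : A) (f : mor U V) : is_zero U \/ is_zero V -> f = 0.
Proof. by case=> [[+ _]|[_]]; apply. Qed.

End Homotopy.

(** * Quasi-isomorphisms on generalized elements, and acyclicity of their cones *)

Section Cohomology.
Variable A : abelian_category.
Implicit Types X Y Z : complex A.

Lemma cohomology_map_comp X Y Z (g : chain_map Y Z) (f : chain_map X Y) i :
  cohomology_map (cm_comp g f) i = cohomology_map g i · cohomology_map f i.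
Proof.
apply: coker_p_epi; rewrite -mcompA !coker_descK mcompA coker_descK -mcompA.
congr (_ · _); apply: ker_i_mono.
by rewrite mcompA !ker_liftK /= -!mcompA ker_liftK.
Qed.

Lemma cohomology_map_id X i : cohomology_map (cm_id X) i = mid _.
Proof.
apply: coker_p_epi; rewrite coker_descK mcomp1m -[RHS]mcompm1.
by congr (_ · _); apply: ker_i_mono; rewrite ker_liftK mcompm1 mcomp1m.
Qed.

Lemma cohomology_map_homotopic X Y (f g : chain_map X Y) i :
  homotopic f g -> cohomology_map f i = cohomology_map g i.
Proof.
move=> [s sE]; apply: coker_p_epi; rewrite !coker_descK.
apply: subr0_eq; rewrite -mcompBr.
suff -> : cocycles_map f i - cocycles_map g i =
    boundary Y i · (s i · ker_i (diff X (i + 1))).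
  by rewrite (mcompA (coker_p _)) (coker_pP _).1 mcomp0m.
apply: ker_i_mono; rewrite mcompBr !ker_liftK -mcompBl sE mcompDl.
by rewrite -(mcompA (s _)) (ker_iP _).1 mcompm0 addr0 [RHS]mcompA ker_liftK mcompA.
Qed.

Lemma quasi_iso_homotopic X Y (f g : chain_map X Y) :
  homotopic f g -> quasi_iso f -> quasi_iso g.
Proof. by move=> fg qf i; rewrite -(cohomology_map_homotopic _ fg). Qed.

Lemma quasi_iso_comp X Y Z (g : chain_map Y Z) (f : chain_map X Y) :
  quasi_iso g -> quasi_iso f -> quasi_iso (cm_comp g f).
Proof.
by move=> qg qf i; rewrite cohomology_map_comp; exact: isomorphism_comp.
Qed.

Lemma quasi_iso_2of3l X Y Z (g : chain_map Y Z) (f : chain_map X Y) :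
  quasi_iso f -> quasi_iso (cm_comp g f) -> quasi_iso g.
Proof.
move=> qf qgf i; move: (qgf i); rewrite cohomology_map_comp.
exact: isomorphism_2of3l.
Qed.

Lemma quasi_iso_2of3r X Y Z (g : chain_map Y Z) (f : chain_map X Y) :
  quasi_iso g -> quasi_iso (cm_comp g f) -> quasi_iso f.
Proof.
move=> qg qgf i; move: (qgf i); rewrite cohomology_map_comp.
exact: isomorphism_2of3r.
Qed.

Lemma homotopy_equivalence_quasi_iso X Y (f : chain_map X Y) (g : chain_map Y X) :
  homotopic (cm_comp g f) (cm_id X) -> homotopic (cm_comp f g) (cm_id Y) ->
  quasi_iso f.
Proof.
move=> gf fg i; exists (cohomology_map g i) => /=.
by rewrite -!cohomology_map_comp (cohomology_map_homotopic _ gf)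
  (cohomology_map_homotopic _ fg) !cohomology_map_id.
Qed.

(** Monomorphy of the maps on cohomology, phrased on cocycles and boundaries: being a boundary is
    tested after refinement along an epimorphism. *)
Definition coh_injective X Y (f : chain_map X Y) : Prop :=
  forall i W (y : mor W (X (i + 1))) (t : mor W (Y i)),
    diff X (i + 1) · y = 0 -> f (i + 1) · y = diff Y i · t ->
    exists W' (c : mor W' W) (t' : mor W' (X i)),
      epi c /\ diff X i · t' = y · c.

Definition coh_surjective X Y (f : chain_map X Y) : Prop :=
  forall i W (z : mor W (Y (i + 1))), diff Y (i + 1) · z = 0 ->
    exists W' (c : mor W' W) (y : mor W' (X (i + 1))) (t : mor W' (Y i)),
      [/\ epi c, diff X (i + 1) · y = 0 & z · c = f (i + 1) · y + diff Y i · t].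

Lemma cohomology_map_coker_p X Y (f : chain_map X Y) i :
  cohomology_map f i · coker_p (boundary X i) =
  coker_p (boundary Y i) · cocycles_map f i.
Proof. by rewrite coker_descK. Qed.

Lemma ker_i_boundary X i : ker_i (diff X (i + 1)) · boundary X i = diff X i.
Proof. by rewrite ker_liftK. Qed.

Lemma ker_i_cocycles_map X Y (f : chain_map X Y) i :
  ker_i (diff Y (i + 1)) · cocycles_map f i = f (i + 1) · ker_i (diff X (i + 1)).
Proof. by rewrite ker_liftK. Qed.

Lemma quasi_iso_coh_injective X Y (f : chain_map X Y) :
  quasi_iso f -> coh_injective f.
Proof.
move=> qf i W y t dy fy; have [y' y'E] := ker_factor dy.
have [g /= [gf fg]] := qf i.
have [|W' [c [t' [ec t'E]]]] := @coker_exact _ _ _ (boundary X i) _ y'.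
  rewrite -[LHS]mcomp1m -gf -mcompA (mcompA (cohomology_map f i)).
  rewrite cohomology_map_coker_p -(mcompA (coker_p _)).
  have -> : cocycles_map f i · y' = boundary Y i · t.
    apply: ker_i_mono; rewrite mcompA ker_i_cocycles_map -mcompA y'E fy.
    by rewrite mcompA ker_i_boundary.
  by rewrite (mcompA (coker_p _)) (coker_pP _).1 mcomp0m mcompm0.
by exists W', c, t'; split=> //; rewrite -ker_i_boundary -mcompA t'E mcompA y'E.
Qed.

Lemma quasi_iso_coh_surjective X Y (f : chain_map X Y) :
  quasi_iso f -> coh_surjective f.
Proof.
move=> qf i W z dz; have [z' z'E] := ker_factor dz.
have [g /= [gf fg]] := qf i.
have [W1 [c1 [y [ec1 yE]]]] := pullback_epi (g · (coker_p (boundary Y i) · z'))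
  (@coker_p_epi _ _ _ (boundary X i)).
have [|W2 [c2 [t [ec2 tE]]]] := @coker_exact _ _ _ (boundary Y i) _
    (z' · c1 - cocycles_map f i · y).
  rewrite mcompBr (mcompA _ (cocycles_map _ _)) -cohomology_map_coker_p.
  rewrite -(mcompA (cohomology_map f i)) yE.
  by rewrite (mcompA (cohomology_map f i)) (mcompA _ g) fg mcomp1m mcompA subrr.
exists W2, (c1 · c2), (ker_i (diff X (i + 1)) · (y · c2)), t; split.
- exact: epi_comp.
- by rewrite mcompA (ker_iP _).1 mcomp0m.
- have -> : diff Y i · t =
      ker_i (diff Y (i + 1)) · ((z' · c1 - cocycles_map f i · y) · c2).
    by rewrite -tE mcompA ker_i_boundary.
  rewrite mcompBl mcompBr -z'E !mcompA ker_i_cocycles_map.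
  by rewrite addrCA subrr addr0.
Qed.

Lemma coh_quasi_iso X Y (f : chain_map X Y) :
  coh_injective f -> coh_surjective f -> quasi_iso f.
Proof.
move=> injf surjf i; apply: mono_epi_iso.
  apply: mono0 => W a fa.
  have [W1 [c1 [y [ec1 yE]]]] := pullback_epi a (@coker_p_epi _ _ _ (boundary X i)).
  have [|W2 [c2 [t [ec2 tE]]]] := @coker_exact _ _ _ (boundary Y i) _
      (cocycles_map f i · y).
    by rewrite mcompA -cohomology_map_coker_p -mcompA yE mcompA fa mcomp0m.
  have [||W3 [c3 [t' [ec3 t'E]]]] :=
      injf i W2 (ker_i (diff X (i + 1)) · (y · c2)) t.
  - by rewrite mcompA (ker_iP _).1 mcomp0m.
  - have -> : diff Y i · t = ker_i (diff Y (i + 1)) · (boundary Y i · t).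
      by rewrite mcompA ker_i_boundary.
    by rewrite tE !mcompA ker_i_cocycles_map.
  apply: (epi_eq0 (epi_comp ec1 (epi_comp ec2 ec3))).
  rewrite mcompA -yE -!mcompA (mcompA y).
  have <- : boundary X i · t' = y · c2 · c3.
    by apply: ker_i_mono; rewrite !mcompA ker_i_boundary t'E !mcompA.
  by rewrite mcompA (coker_pP _).1 mcomp0m.
apply: epi0 => M w wf; apply: (epi_eq0 (@coker_p_epi _ _ _ (boundary Y i))).
have [W [c [y [t [ec dy yE]]]]] := surjf i _ _ (ker_iP (diff Y (i + 1))).1.
apply: (epi_eq0 ec); have [y' y'E] := ker_factor dy.
have -> : w · coker_p (boundary Y i) · c =
    w · coker_p (boundary Y i) · (cocycles_map f i · y' + boundary Y i · t).
  congr (_ · _); apply: ker_i_mono.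
  rewrite yE mcompDr !(mcompA (ker_i _)) ker_i_cocycles_map ker_i_boundary.
  by rewrite -mcompA y'E.
rewrite mcompDr -!(mcompA w) !(mcompA (coker_p _)) -cohomology_map_coker_p.
by rewrite (coker_pP _).1 mcomp0m mcompm0 addr0 !mcompA wf !mcomp0m.
Qed.

Definition acyclic X : Prop := forall i, exact_at (diff X i) (diff X (i + 1)).

(** For a cocycle [(a, b)] of the cone, [f a = - d b], so injectivity on cohomology gives
    [a = d t']. Then [b + f t'] is a cocycle, equal to [f x + d t] by surjectivity, and
    [(x - t', t)] bounds [(a, b)], all up to refinement. *)
Lemma cone_acyclic X Y (f : chain_map X Y) : quasi_iso f -> acyclic (cone f).
Proof.
move=> qf i W y; rewrite [diff _ _]/(cone_diff f (i + 1)) => dy.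
have dl : diff X (i + 1 + 1) · (prl_ _ _ · y) = 0.
  apply: oppr_inj; rewrite oppr0 -mcompNm mcompA -(cone_diff_prl f) -mcompA.
  by rewrite dy mcompm0.
have dr : f (i + 1 + 1) · (prl_ _ _ · y) + diff Y (i + 1) · (prr_ _ _ · y) = 0.
  by rewrite !mcompA -mcompDl -cone_diff_prr -mcompA dy mcompm0.
have [|W1 [c1 [t' [ec1 t'E]]]] := quasi_iso_coh_injective qf
    (t := - (prr_ (X (i + 1 + 1)) (Y (i + 1)) · y)) dl.
  by rewrite mcompmN; apply/eqP; rewrite -addr_eq0 dr.
have [|W2 [c2 [x [t [ec2 dx xE]]]]] := quasi_iso_coh_surjective qf
    (z := prr_ (X (i + 1 + 1)) (Y (i + 1)) · y · c1 + f (i + 1) · t').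
  rewrite mcompDr (mcompA _ (f _)) cmapE -(mcompA (f _)) t'E !mcompA -mcompDl.
  by rewrite -!mcompA [X in X · _]addrC dr mcomp0m.
exists W2, (c1 · c2), (mpair (x - t' · c2) t); split; first exact: epi_comp.
apply: biprod_ext; rewrite [diff _ _]/(cone_diff f i).
  rewrite (mcompA _ (cone_diff f i)) cone_diff_prl -mcompA prl_mpair mcompBr.
  by rewrite !mcompNm dx oppr0 add0r opprK mcompA t'E !mcompA.
rewrite (mcompA _ (cone_diff f i)) cone_diff_prr mcompDl -!mcompA.
rewrite prl_mpair prr_mpair mcompBr addrAC -xE mcompDl -!mcompA.
by rewrite -addrA subrr addr0.
Qed.

Lemma cone_diff_inl X Y (f : chain_map X Y) i :
  cone_diff f i · inl_ _ _ = inl_ _ _ · (- diff X (i + 1)) + inr_ _ _ · f (i + 1).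
Proof.
by rewrite /cone_diff /cone_ob mcompDl -!mcompA mcompDl -!mcompA
  prl_inl prr_inl !mcompm0 !mcompm1 addr0.
Qed.

End Cohomology.

(** * Maps between acyclic complexes and complexes of projectives or injectives *)

Section AcyclicNull.
Variable A : abelian_category.
Implicit Types X Y : complex A.

(** The homotopy is zero in high degrees, where [P] vanishes, and is built downwards: the remaining
    error is a cocycle of [N], lifted along the differential by projectivity. *)
Lemma projective_acyclic_null (P N : complex A) (f : chain_map P N) :
  bounded_above P -> (forall i, projective (P i)) -> acyclic N ->
  null_homotopic f.
Proof.
move=> [n Pn] projP acN.
pose R i (s : mor (P (i + 1)) (N i)) (s' : mor (P (i + 1 + 1)) (N (i + 1))) :=
  f (i + 1) = diff N i · s + s' · diff P (i + 1).
apply: (@descending_family _ R n (fun=> 0)) => [i ni|i t1 t2 tE].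
  rewrite /R mcompm0 mcomp0m addr0; apply: is_zero_hom0.
  by left; apply: Pn; rewrite ltzD1.
have [||t tE'] := @exact_projective _ _ _ _ _ _ _
    (f (i + 1) - t1 · diff P (i + 1)) (acN i).
- exact: projP.
- rewrite mcompBr cmapE tE mcompDl -!mcompA diffK mcompm0 addr0.
  by rewrite subrr.
- by exists t; rewrite /R tE' subrK.
Qed.

Lemma injective_acyclic_null (N I : complex A) (f : chain_map N I) :
  bounded_below I -> (forall i, injective_object (I i)) -> acyclic N ->
  null_homotopic f.
Proof.
move=> [n In] injI acN.
pose R i (s : mor (N (i + 1)) (I i)) (s' : mor (N (i + 1 + 1)) (I (i + 1))) :=
  f (i + 1) = diff I i · s + s' · diff N (i + 1).
(* [R] at [i] concerns maps into [I (i + 1)], which vanishes when [i + 1 < n], that is for [i] at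
   most [n - 2]. *)
apply: (@ascending_family _ R (n - 1 - 1) (fun=> 0)) => [i ni|i t0 t1 tE].
  rewrite /R mcompm0 mcomp0m addr0; apply: is_zero_hom0; right; apply: In.
  by rewrite -ltrBrDr (le_lt_trans ni) // ltrBlDr ltrDl.
have [||t tE'] := @exact_injective _ _ _ _ _ _ _
    (f (i + 1 + 1) - diff I (i + 1) · t1) (acN (i + 1)).
- exact: injI.
- rewrite mcompBl -cmapE tE mcompDr !mcompA diffK mcomp0m add0r.
  by rewrite subrr.
- by exists t; rewrite /R tE' subrKC.
Qed.

End AcyclicNull.

(** * Null-homotopies around a mapping cone *)

Section ConeLifting.
Variables (A : abelian_category) (X Y : complex A) (f : chain_map X Y).
Implicit Type P : complex A.

(** The two components of the null-homotopy separate the data: the one in [X] is the lift, the one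
    in [Y] is the homotopy. *)
Lemma cone_in_null_lift P (p : chain_map P Y) :
  null_homotopic (cm_comp (cone_in f) p) ->
  exists p' : chain_map P X, homotopic (cm_comp f p') p.
Proof.
move=> [s sE].
have [i|p' p'E] := @unshift_chain_map _ P X (fun i => prl_ _ _ · s i).
  have /(congr1 (fun u => prl_ _ _ · u)) := sE i.
  rewrite /= mcompDr !mcompA prl_inr mcomp0m cone_diff_prl !mcompNm.
  by move/esym/eqP; rewrite (addrC (- _)) subr_eq0 => /eqP.
exists p'; apply: homotopic_sym; exists (fun i => prr_ _ _ · s i) => i.
have /(congr1 (fun u => prr_ _ _ · u)) := sE i.
rewrite /= p'E mcompDr !mcompA prr_inr mcomp1m cone_diff_prr mcompDl => ->.
by rewrite -!mcompA -(addrA (_ · _)) addrACK.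
Qed.

(** Subtracting [f s] from the [Y] component of [p] corrects it to a chain map, and [s], placed in
    the [X] summand, is the homotopy back to [p]. *)
Lemma cone_out_null_lift P (p : chain_map P (cone f)) :
  null_homotopic (cm_comp (cone_out f) p) ->
  exists p' : chain_map P Y, homotopic (cm_comp (cone_in f) p') p.
Proof.
move=> [s sE]; have {}sE i : prl_ _ _ · p (i + 1) =
    s (i + 1) · diff P (i + 1) - diff X (i + 1) · s i.
  by rewrite [LHS]sE /= mcompNm (addrC (- _)).
have [i|p' p'E] := @unshift_chain_map _ P Y
    (fun i => prr_ _ _ · p (i + 1) - f (i + 1) · s i).
  have pE := congr1 (fun u => prr_ _ _ · u) (cmapE p (i + 1)).
  rewrite /= mcompA cone_diff_prr mcompDl -!mcompA sE mcompBr in pE.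
  rewrite mcompBr mcompBl -(mcompA (prr_ _ _)) -pE (mcompA _ (f _)) cmapE -!mcompA.
  by rewrite -(addrA (_ · _)) addrACK (addrC (- _)).
exists p'; apply: homotopic_sym.
exists (fun i => inl_ _ _ · s i) => i; apply: biprod_ext.
  rewrite mcompBr /= mcompA prl_inr mcomp0m subr0 sE.
  rewrite mcompDr !mcompA cone_diff_prl -(mcompA _ (prl_ _ _)) !prl_inl mcompm1.
  by rewrite mcomp1m mcompNm (addrC (- _)).
rewrite mcompBr /= p'E mcompA prr_inr mcomp1m.
rewrite mcompDr (mcompA (cone_diff f i)) cone_diff_inl mcompDl mcompDr !mcompA.
by rewrite prr_inr !prr_inl !mcomp0m mcomp1m add0r addr0 opprB subrKC.
Qed.

(** Restricted to the summand [Y], the null-homotopy is the extension; restricted to the summand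
    from [X], it is the homotopy, one degree up, whence the reindexing. *)
Lemma cone_out_null_extend J (j : chain_map X J) :
  null_homotopic (cm_comp (cshift_map j) (cone_out f)) ->
  exists j' : chain_map Y J, homotopic (cm_comp j' f) j.
Proof.
move=> [s sE].
have [i|j' j'E] := @unshift_chain_map _ Y J (fun i => s i · inr_ _ _).
  have /(congr1 (fun u => u · inr_ _ _)) := sE i.
  rewrite /= mcompDl -!mcompA prl_inr cone_diff_inr mcompm0 mcompNm.
  by move/esym/eqP; rewrite (addrC (- _)) subr_eq0 => /eqP/esym; rewrite !mcompA.
have [h hE] := @unshift_family (fun i => mor (X (i + 1)) (J i))
  (fun i => s i · inl_ _ _).
exists j', h; apply: int_succP => i; rewrite !hE.
have /(congr1 (fun u => u · inl_ _ _)) := sE i.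
rewrite /= mcompDl -!mcompA prl_inl cone_diff_inl mcompm1 => ->.
rewrite j'E mcompDr !mcompA mcompNm opprD mcompmN.
rewrite mcompNm opprK (opprD (- _)) opprK (addrA (diff J _ · _ · _)) subrKC.
by [].
Qed.

Lemma cone_rotate_null : null_homotopic (cm_comp (cshift_map f) (cone_out f)).
Proof.
exists (fun i => prr_ _ _) => i /=.
by rewrite cone_diff_prr mcompNm addrCA addNr addr0.
Qed.
End ConeLifting.

(** * Quasi-isomorphisms act bijectively on homotopy classes *)

Section HomotopyUniqueness.
Variables (A : abelian_category) (X Y : complex A) (f : chain_map X Y).
Hypothesis qf : quasi_iso f.

(** The pair [(p - q, - t)], with [t] the given homotopy, is a chain map from the shift of [P] to
    the acyclic cone of [f]. It is null-homotopic, and the [X] component of the null-homotopy, up to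
    sign, joins [p] to [q]. *)
Lemma projective_homotopic_cancel P (p q : chain_map P X) :
  bounded_above P -> (forall i, projective (P i)) ->
  homotopic (cm_comp f p) (cm_comp f q) -> homotopic p q.
Proof.
move=> bP projP [t tE].
have thC i : diff (cone f) i · mpair (p (i + 1) - q (i + 1)) (- t i) =
    mpair (p (i + 1 + 1) - q (i + 1 + 1)) (- t (i + 1)) · diff (cshift P) i.
  apply: biprod_ext; rewrite /= !mcompA.
    rewrite cone_diff_prl prl_mpair -mcompA prl_mpair mcompNm mcompmN.
    by rewrite mcompBr mcompBl !cmapE.
  rewrite cone_diff_prr prr_mpair mcompDl -!mcompA prl_mpair prr_mpair.
  by rewrite mcompBr tE !mcompmN mcompNm opprK addrACK.
have bP' : bounded_above (cshift P).
  exact: (@has_bound_cshift BoundedAbove _ _ bP).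
pose th := @ChainMap A (cshift P) (cone f)
  (fun i => mpair (p (i + 1) - q (i + 1)) (- t i)) thC.
have [s sE] := projective_acyclic_null th bP' (fun i => projP (i + 1)) (cone_acyclic qf).
have [h hE] := @unshift_family (fun i => mor (P (i + 1)) (X i))
  (fun i => - (prl_ _ _ · s i)).
exists h; apply: int_succP => i; rewrite !hE.
have /(congr1 (fun u => prl_ _ _ · u)) := sE i.
rewrite /= prl_mpair mcompDr !mcompA cone_diff_prl !mcompmN !mcompNm => ->.
by rewrite mcompA.
Qed.

(** Dually, [t] and [p - q] together form a chain map from the acyclic cone to [I], and its
    null-homotopy is restricted to [Y]. *)
Lemma injective_homotopic_cancel I (p q : chain_map Y I) :
  bounded_below I -> (forall i, injective_object (I i)) ->
  homotopic (cm_comp p f) (cm_comp q f) -> homotopic p q.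
Proof.
move=> bI injI [t tE].
have thC i : diff I i · mcopair (t i) (p i - q i) =
    mcopair (t (i + 1)) (p (i + 1) - q (i + 1)) · diff (cone f) i.
  apply: biprod_coext; rewrite [diff (cone _) _]/(cone_diff f i).
    rewrite -mcompA mcopair_inl -(mcompA (mcopair _ _) (cone_diff f i)).
    rewrite cone_diff_inl mcompDr !mcompA mcopair_inl mcopair_inr.
    by rewrite mcompBl [p _ · _ - _]tE mcompmN addrCA addNr addr0.
  rewrite -mcompA mcopair_inr -(mcompA (mcopair _ _) (cone_diff f i)).
  rewrite cone_diff_inr mcompA mcopair_inr.
  by rewrite mcompBr mcompBl !cmapE.
pose th := @ChainMap A (cone f) I (fun i => mcopair (t i) (p i - q i)) thC.
have [s sE] := injective_acyclic_null th bI injI (cone_acyclic qf).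
exists (fun i => s i · inr_ _ _) => i.
have /(congr1 (fun u => u · inr_ _ _)) := sE i.
rewrite /= mcopair_inr mcompDl -!mcompA cone_diff_inr => ->.
by rewrite !mcompA.
Qed.

Lemma projective_lift P (p : chain_map P Y) :
  bounded_above P -> (forall i, projective (P i)) ->
  exists p' : chain_map P X, homotopic (cm_comp f p') p.
Proof.
move=> bP projP; apply: cone_in_null_lift.
exact: projective_acyclic_null (cone_acyclic qf).
Qed.

Lemma injective_extend I (p : chain_map X I) :
  bounded_below I -> (forall i, injective_object (I i)) ->
  exists p' : chain_map Y I, homotopic (cm_comp p' f) p.
Proof.
move=> bI injI; apply: cone_out_null_extend.
apply: injective_acyclic_null (cone_acyclic qf) => [|i]; last exact: injI.
exact: (@has_bound_cshift BoundedBelow _ _ bI).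
Qed.

End HomotopyUniqueness.

(** * The derived category acting on homotopy classes *)

(* A functor from the localization at [W] to sets with relations as morphisms;
   allowing relations treats covariant and contravariant functors alike. *)
Record local_relations (C : category) (W : forall X Y : C, hom X Y -> Prop) :=
  LocalRelations {
  lr_ob :> C -> Type;
  lr_eq : forall X, lr_ob X -> lr_ob X -> Prop;
  lr_rel : forall X Y, hom X Y -> lr_ob X -> lr_ob Y -> Prop;
  lr_refl : forall X (x : lr_ob X), lr_eq x x;
  lr_sym : forall X (x y : lr_ob X), lr_eq x y -> lr_eq y x;
  lr_trans : forall X (x y z : lr_ob X), lr_eq x y -> lr_eq y z -> lr_eq x z;
  lr_eqrel : forall X Y (f : hom X Y) x x' y y',
    lr_eq x x' -> lr_eq y y' -> lr_rel f x y -> lr_rel f x' y';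
  lr_id : forall X (x y : lr_ob X), lr_rel (idm X) x y <-> lr_eq x y;
  lr_comp : forall X Y Z (g : hom Y Z) (f : hom X Y) x z,
    lr_rel (g ∘ f) x z <-> exists2 y, lr_rel f x y & lr_rel g y z;
  lr_inj : forall X Y (s : hom X Y) x x' y, W _ _ s ->
    lr_rel s x y -> lr_rel s x' y -> lr_eq x x';
  lr_fun : forall X Y (s : hom X Y) x y y', W _ _ s ->
    lr_rel s x y -> lr_rel s x y' -> lr_eq y y';
  lr_surj : forall X Y (s : hom X Y) y, W _ _ s -> exists x, lr_rel s x y;
  lr_total : forall X Y (s : hom X Y) x, W _ _ s -> exists y, lr_rel s x y
}.

Section ZigzagRelation.
Variables (C : category) (W : forall X Y : C, hom X Y -> Prop).
Variable E : local_relations W.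

Fixpoint zz_rel X Y (u : zigzag W X Y) : E X -> E Y -> Prop :=
  match u in zigzag _ X0 Y0 return E X0 -> E Y0 -> Prop with
  | zz_nil _ => @lr_eq _ _ E _
  | zz_fwd _ _ _ f w => fun x z => exists2 y, lr_rel f x y & zz_rel w y z
  | zz_bwd _ _ _ s _ w => fun x z => exists2 y, lr_rel s y x & zz_rel w y z
  end.

Lemma zz_rel_eqrel X Y (u : zigzag W X Y) (x x' : E X) (y y' : E Y) :
  lr_eq x x' -> lr_eq y y' -> zz_rel u x y -> zz_rel u x' y'.
Proof.
elim: u x x' y y' => {X Y} /=.
- move=> X x x' y y' xx' yy' xy.
  exact: lr_trans (lr_trans (lr_sym xx') xy) yy'.
- move=> X Y Z f w IH x x' z z' xx' zz' [y fxy wyz]; exists y.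
    exact: lr_eqrel xx' (lr_refl y) fxy.
  exact: IH (lr_refl y) zz' wyz.
- move=> X Y Z s Ws w IH x x' z z' xx' zz' [y sxy wyz]; exists y.
    exact: lr_eqrel (lr_refl y) xx' sxy.
  exact: IH (lr_refl y) zz' wyz.
Qed.

(** The relation descends to the localization. Cancelling [s] followed by its inverse uses that [s]
    is total and injective; the opposite order uses that it is surjective and functional. *)
Lemma zz_rel_eq X Y (u v : zigzag W X Y) (x : E X) (y : E Y) :
  zz_eq u v -> zz_rel u x y <-> zz_rel v x y.
Proof.
move=> uv; elim: uv x y => {X Y u v} //=.
- by move=> X Y u v _ IH x y; rewrite IH.
- by move=> X Y u v w _ IHu _ IHv x y; rewrite IHu.
- by move=> X Y Z f u v _ IH x z; split=> -[y fxy] /IH; exists y.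
- by move=> X Y Z s Ws u v _ IH x z; split=> -[y sxy] /IH; exists y.
- move=> X Y u x y; split=> [[x' /lr_id xx']|].
    exact: zz_rel_eqrel (lr_sym xx') (lr_refl y).
  by exists x => //; apply/lr_id/lr_refl.
- move=> X Y Z T f g w x t; split.
    by move=> [y fxy [z gyz wzt]]; exists z => //; apply/lr_comp; exists y.
  by move=> [z /lr_comp[y fxy gyz] wzt]; exists y => //; exists z.
- move=> X Y Z s Ws w x z; split.
    move=> [y sxy [x' sx'y wxz]].
    exact: zz_rel_eqrel (lr_inj Ws sx'y sxy) (lr_refl z) wxz.
  by move=> wxz; have [y sxy] := lr_total x Ws; exists y => //; exists x.
- move=> X Y Z s Ws w x z; split.
    move=> [y syx [x' syx' wxz]].
    exact: zz_rel_eqrel (lr_fun Ws syx' syx) (lr_refl z) wxz.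
  by move=> wxz; have [y syx] := lr_surj x Ws; exists y => //; exists x.
Qed.

Lemma zz_rel_cat X Y Z (u : zigzag W X Y) (v : zigzag W Y Z) (x : E X) (z : E Z) :
  zz_rel (zz_cat u v) x z <-> exists2 y, zz_rel u x y & zz_rel v y z.
Proof.
elim: u v x z => {X Y} /=.
- move=> X v x z; split=> [vxz|[y xy]].
    by exists x => //; exact: lr_refl.
  exact: zz_rel_eqrel (lr_sym xy) (lr_refl z).
- move=> X Y T f w IH v x z; split.
    by move=> [y fxy /IH[t wyt vtz]]; exists t => //; exists y.
  by move=> [t [y fxy wyt] vtz]; exists y => //; apply/IH; exists t.
- move=> X Y T s Ws w IH v x z; split.
    by move=> [y fxy /IH[t wyt vtz]]; exists t => //; exists y.
  by move=> [t [y fxy wyt] vtz]; exists y => //; apply/IH; exists t.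
Qed.

Local Notation L := (localization W).

Definition loc_rel (X Y : L) (f : hom X Y) : E X -> E Y -> Prop :=
  zz_rel (loc_word f).

Lemma loc_relE X Y (u : zigzag W X Y) x y :
  loc_rel (loc_class u) x y <-> zz_rel u x y.
Proof. exact/zz_rel_eq/loc_classK. Qed.

Lemma loc_rel_id (X : L) (x y : E X) : loc_rel (idm X) x y <-> lr_eq x y.
Proof. exact: loc_relE. Qed.

Lemma loc_rel_comp (X Y Z : L) (g : hom Y Z) (f : hom X Y) (x : E X) (z : E Z) :
  loc_rel (g ∘ f) x z <-> exists2 y, loc_rel f x y & loc_rel g y z.
Proof. by rewrite loc_relE zz_rel_cat. Qed.

Lemma loc_rel_map (X Y : C) (f : hom X Y) (x : E X) (y : E Y) :
  loc_rel (loc_map W f) x y <-> lr_rel f x y.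
Proof.
rewrite loc_relE /=; split=> [[y' fxy yy']|].
  exact: lr_eqrel (lr_refl x) yy' fxy.
by exists y => //; exact: lr_refl.
Qed.

Lemma loc_rel_eqrel (X Y : L) (f : hom X Y) (x x' : E X) (y y' : E Y) :
  lr_eq x x' -> lr_eq y y' -> loc_rel f x y -> loc_rel f x' y'.
Proof. exact: zz_rel_eqrel. Qed.

Section Isomorphism.
Variables (X Y : L) (a : hom X Y).
Hypothesis iso_a : is_iso a.

Lemma loc_rel_iso_total (x : E X) : exists y, loc_rel a x y.
Proof.
have [b [ba _]] := iso_a.
have /loc_rel_id := lr_refl x; rewrite -ba => /loc_rel_comp[y axy _].
by exists y.
Qed.

Lemma loc_rel_iso_inj (x x' : E X) (y : E Y) :
  loc_rel a x y -> loc_rel a x' y -> lr_eq x x'.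
Proof.
have [b [ba ab]] := iso_a => axy ax'y.
have /loc_rel_id := lr_refl y; rewrite -ab => /loc_rel_comp[z byz _].
have eqz t : loc_rel a t y -> lr_eq t z.
  by move=> aty; apply/loc_rel_id; rewrite -ba; apply/loc_rel_comp; exists y.
exact: lr_trans (eqz _ axy) (lr_sym (eqz _ ax'y)).
Qed.

Lemma loc_rel_iso_fun (x : E X) (y y' : E Y) :
  loc_rel a x y -> loc_rel a x y' -> lr_eq y y'.
Proof.
have [b [ba ab]] := iso_a => axy axy'.
have /loc_rel_id := lr_refl x; rewrite -ba => /loc_rel_comp[z _ bzx].
have eqz t : loc_rel a x t -> lr_eq z t.
  by move=> axt; apply/loc_rel_id; rewrite -ab; apply/loc_rel_comp; exists x.
exact: lr_trans (lr_sym (eqz _ axy)) (eqz _ axy').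
Qed.

End Isomorphism.

Lemma loc_rel_total (X Y : L) (f : hom X Y) (x : E X) :
  (forall (X Y : C) (f : hom X Y) (x : E X), exists y, lr_rel f x y) ->
  exists y, loc_rel f x y.
Proof.
move=> tot; rewrite /loc_rel; elim: (loc_word f) x => {X Y f} /=.
- by move=> X x; exists x; exact: lr_refl.
- move=> X Y Z f w IH x; have [y fxy] := tot _ _ f x.
  by have [z wyz] := IH y; exists z, y.
- move=> X Y Z s Ws w IH x; have [y fxy] := lr_surj x Ws.
  by have [z wyz] := IH y; exists z, y.
Qed.

Lemma loc_rel_surj (X Y : L) (f : hom X Y) (y : E Y) :
  (forall (X Y : C) (f : hom X Y) (y : E Y), exists x, lr_rel f x y) ->
  exists x, loc_rel f x y.
Proof.
move=> sur; rewrite /loc_rel; elim: (loc_word f) y => {X Y f} /=.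
- by move=> X x; exists x; exact: lr_refl.
- move=> X Y Z f w IH z; have [y wyz] := IH z.
  by have [x fxy] := sur _ _ f y; exists x, y.
- move=> X Y Z s Ws w IH z; have [y wyz] := IH z.
  by have [x fxy] := lr_total y Ws; exists x, y.
Qed.

(** A point related to itself by every arrow is so along arrows read backwards too. The case of
    interest is the zero map. *)
Lemma loc_rel_point (p : forall X, E X) (X Y : L) (f : hom X Y) :
  (forall (X Y : C) (f : hom X Y), lr_rel f (p X) (p Y)) -> loc_rel f (p X) (p Y).
Proof.
move=> pf; rewrite /loc_rel; elim: (loc_word f) => {X Y f} /=.
- by move=> X; exact: lr_refl.
- by move=> X Y Z f w IH; exists (p Y).
- by move=> X Y Z s Ws w IH; exists (p Y).
Qed.

End ZigzagRelation.

(** A natural transformation stays natural on zigzags. It serves for composition with the inclusion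
    of, or projection to, a brutal truncation. *)
Lemma zz_rel_map (C : category) (W : forall X Y : C, hom X Y -> Prop)
    (E E' : local_relations W) (t : forall X, E X -> E' X) :
  (forall X (x y : E X), lr_eq x y -> lr_eq (t X x) (t X y)) ->
  (forall X Y (f : hom X Y) (x : E X) (y : E Y), lr_rel f x y ->
    lr_rel f (t X x) (t Y y)) ->
  forall X Y (u : zigzag W X Y) (x : E X) (y : E Y),
    zz_rel u x y -> zz_rel u (t X x) (t Y y).
Proof.
move=> teq trel X Y u; elim: u => {X Y} /=.
- exact: teq.
- by move=> X Y Z f w IH x z [y /trel fxy /IH wyz]; exists (t Y y).
- by move=> X Y Z s Ws w IH x z [y /trel sxy /IH wyz]; exists (t Y y).
Qed.

(** * Homotopy classes and cohomology as invariants of derived morphisms *)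

Section DerivedRelations.
Variables (A : abelian_category) (b : boundedness).

Local Notation CA := (bounded_complexes b A).
Local Notation qis := (@bounded_quasi_iso b A).
Local Notation DA := (localization qis).

Section FromProjective.
Variable P : complex A.
Hypotheses (bP : bounded_above P) (projP : forall i, projective (P i)).

Definition from_rel (U V : CA) (f : hom U V) (p : chain_map P (sval U))
  (q : chain_map P (sval V)) : Prop := homotopic (cm_comp f p) q.

Program Definition from_relations : local_relations qis :=
  @LocalRelations CA qis (fun U => chain_map P (sval U))
    (fun U => @homotopic A P (sval U)) from_rel _ _ _ _ _ _ _ _ _ _.
Next Obligation. exact: homotopic_refl. Qed.
Next Obligation. exact: homotopic_sym. Qed.
Next Obligation. exact: homotopic_trans H H0. Qed.
Next Obligation.
apply: (homotopic_trans _ H0); apply: (homotopic_trans _ H1).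
exact/homotopic_compl/homotopic_sym.
Qed.
Next Obligation. by rewrite /from_rel /= cm_comp1m. Qed.
Next Obligation.
rewrite /from_rel /= -cm_compA; split=> [gf|[y fxy gyz]].
  by exists (cm_comp f x) => //; exact: homotopic_refl.
exact: homotopic_trans (homotopic_compl g fxy) gyz.
Qed.
Next Obligation.
apply: (projective_homotopic_cancel H) => //.
exact: homotopic_trans H0 (homotopic_sym H1).
Qed.
Next Obligation. exact: homotopic_trans (homotopic_sym H0) H1. Qed.
Next Obligation. exact: (projective_lift H). Qed.
Next Obligation. by exists (cm_comp s x); exact: homotopic_refl. Qed.

Lemma from_rel_total (U V : CA) (f : hom U V) (p : from_relations U) :
  exists q : from_relations V, lr_rel f p q.
Proof. by exists (cm_comp f p); exact: homotopic_refl. Qed.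

End FromProjective.

Section ToInjective.
Variable I : complex A.
Hypotheses (bI : bounded_below I) (injI : forall i, injective_object (I i)).

(** Maps into [I] are contravariant, so this is the graph of precomposition with [f] read backwards:
    [q] determines [p] up to homotopy. *)
Definition to_rel (U V : CA) (f : hom U V) (p : chain_map (sval U) I)
  (q : chain_map (sval V) I) : Prop := homotopic p (cm_comp q f).

Program Definition to_relations : local_relations qis :=
  @LocalRelations CA qis (fun U => chain_map (sval U) I)
    (fun U => @homotopic A (sval U) I) to_rel _ _ _ _ _ _ _ _ _ _.
Next Obligation. exact: homotopic_refl. Qed.
Next Obligation. exact: homotopic_sym. Qed.
Next Obligation. exact: homotopic_trans H H0. Qed.
Next Obligation.
apply: (homotopic_trans (homotopic_sym H)); apply: (homotopic_trans H1).
exact/homotopic_compr.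
Qed.
Next Obligation. by rewrite /to_rel /= cm_compm1. Qed.
Next Obligation.
rewrite /to_rel /= cm_compA; split=> [gf|[y fxy gyz]].
  by exists (cm_comp z g) => //; exact: homotopic_refl.
exact: homotopic_trans fxy (homotopic_compr f gyz).
Qed.
Next Obligation. exact: homotopic_trans H0 (homotopic_sym H1). Qed.
Next Obligation.
apply: (injective_homotopic_cancel H) => //.
exact: homotopic_trans (homotopic_sym H0) H1.
Qed.
Next Obligation. by exists (cm_comp y s); exact: homotopic_refl. Qed.
Next Obligation.
have [p' /homotopic_sym p'E] := injective_extend H x bI injI.
by exists p'.
Qed.

Lemma to_rel_surj (U V : CA) (f : hom U V) (q : to_relations V) :
  exists p : to_relations U, lr_rel f p q.
Proof. by exists (cm_comp q f); exact: homotopic_refl. Qed.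

End ToInjective.

Section ZigzagCohomology.
Variable i : int.

(** Cohomology as a functor on zigzags: a backward arrow contributes a chosen inverse of the
    isomorphism it induces. *)
Fixpoint zz_coh (U V : CA) (u : zigzag qis U V) :
    mor (cohomology (sval U) i) (cohomology (sval V) i) :=
  match u in zigzag _ U0 V0
    return mor (cohomology (sval U0) i) (cohomology (sval V0) i) with
  | zz_nil _ => mid _
  | zz_fwd _ _ _ f w => zz_coh w · cohomology_map f i
  | zz_bwd _ _ _ s qs w => zz_coh w · sval (cid (qs i))
  end.

Lemma zz_coh_eq (U V : CA) (u v : zigzag qis U V) :
  zz_eq u v -> zz_coh u = zz_coh v.
Proof.
elim=> {U V u v} //=.
- by move=> U V u v w _ -> _ ->.
- by move=> U V T f u v _ ->.
- by move=> U V T s qs u v _ ->.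
- by move=> U V w; rewrite cohomology_map_id mcompm1.
- by move=> U V S T f g w; rewrite cohomology_map_comp mcompA.
- move=> U V T s qs w; case: cid => k /= [ks _].
  by rewrite -mcompA ks mcompm1.
- move=> U V T s qs w; case: cid => k /= [_ sk].
  by rewrite -mcompA sk mcompm1.
Qed.

Lemma zz_coh_cat (U V T : CA) (u : zigzag qis U V) (v : zigzag qis V T) :
  zz_coh (zz_cat u v) = zz_coh v · zz_coh u.
Proof.
elim: u v => {U V} /= [U v|U V S f w IH v|U V S s qs w IH v].
- by rewrite mcompm1.
- by rewrite IH mcompA.
- by rewrite IH mcompA.
Qed.

Lemma loc_coh_iso (U V : DA) (a : hom U V) :
  is_iso a -> isomorphism (zz_coh (loc_word a)).
Proof.
move=> [c [ca ac]]; exists (zz_coh (loc_word c)) => /=; rewrite -!zz_coh_cat.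
split; first by rewrite (zz_coh_eq (v := @zz_nil CA qis U)) //; exact/loc_classP.
by rewrite (zz_coh_eq (v := @zz_nil CA qis V)) //; exact/loc_classP.
Qed.

End ZigzagCohomology.

(** On cohomology [q] is [p] followed by the map induced by [a], which is invertible. *)
Lemma from_rel_iso_quasi_iso P (bP : bounded_above P)
    (projP : forall i, projective (P i)) (U V : DA) (a : hom U V) p q :
  is_iso a -> @loc_rel _ _ (from_relations bP projP) U V a p q ->
  quasi_iso p -> quasi_iso q.
Proof.
move=> iso_a apq qp i.
suff -> : cohomology_map q i = zz_coh i (loc_word a) · cohomology_map p i.
  exact: isomorphism_comp (loc_coh_iso i iso_a) (qp i).
move: apq; rewrite /loc_rel; elim: (loc_word a) p q {qp} => /=.
- by move=> X x y /cohomology_map_homotopic->; rewrite mcomp1m.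
- move=> X Y Z f w IH x z [y fxy /IH->]; rewrite -(cohomology_map_homotopic _ fxy).
  by rewrite cohomology_map_comp mcompA.
- move=> X Y Z s qs w IH x z [y fxy /IH->]; rewrite -(cohomology_map_homotopic _ fxy).
  rewrite cohomology_map_comp; case: cid => k /= [ks _].
  by rewrite -mcompA (mcompA k) ks mcomp1m.
Qed.

Lemma to_rel_iso_quasi_iso I (bI : bounded_below I)
    (injI : forall i, injective_object (I i)) (U V : DA) (a : hom U V) p q :
  is_iso a -> @loc_rel _ _ (to_relations bI injI) U V a p q ->
  quasi_iso p -> quasi_iso q.
Proof.
move=> iso_a apq qp i.
have E : cohomology_map p i = cohomology_map q i · zz_coh i (loc_word a).
  move: apq; rewrite /loc_rel; elim: (loc_word a) p q {qp} => /=.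
  - by move=> X x y /cohomology_map_homotopic->; rewrite mcompm1.
  - move=> X Y Z f w IH x z [y fxy /IH E]; rewrite (cohomology_map_homotopic _ fxy).
    by rewrite cohomology_map_comp E mcompA.
  - move=> X Y Z s qs w IH x z [y fxy /IH E].
    rewrite mcompA -E (cohomology_map_homotopic _ fxy) cohomology_map_comp.
    by case: cid => k /= [_ sk]; rewrite -mcompA sk mcompm1.
have := qp i; rewrite E; apply: isomorphism_2of3l.
exact: loc_coh_iso.
Qed.

Lemma zz_rel_cshift I (bI : bounded_below I)
    (injI : forall i, injective_object (I i))
    (bI' : bounded_below (cshift I))
    (injI' : forall i, injective_object (cshift I i))
    (U V : CA) (u : zigzag qis U V) p q :
  @zz_rel _ _ (to_relations bI injI) U V u p q ->
  @zz_rel _ _ (to_relations bI' injI') _ _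
    (zz_map (@bounded_shift_quasi_iso b A) u) (cshift_map p) (cshift_map q).
Proof.
elim: u p q => {U V} /=.
- by move=> U p q; exact: homotopic_cshift.
- move=> U V T f w IH p q [r /homotopic_cshift pr /IH rq].
  by exists (cshift_map r) => //; rewrite cshift_map_comp in pr.
- move=> U V T s qs w IH p q [r /homotopic_cshift pr /IH rq].
  by exists (cshift_map r) => //; rewrite cshift_map_comp in pr.
Qed.

Lemma loc_rel_cshift I (bI : bounded_below I)
    (injI : forall i, injective_object (I i))
    (bI' : bounded_below (cshift I))
    (injI' : forall i, injective_object (cshift I i))
    (U V : DA) (a : hom U V) p q :
  @loc_rel _ _ (to_relations bI injI) U V a p q ->
  @loc_rel _ _ (to_relations bI' injI') _ _
    (fhom (derived_shift b A) a) (cshift_map p) (cshift_map q).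
Proof. by move=> apq; apply/loc_relE; exact: zz_rel_cshift apq. Qed.

End DerivedRelations.

(** * Truncations *)

Section Splitting.
Variables (A : abelian_category) (X : complex A) (e : forall i, mor (X i) (X i)).
Hypothesis e_idem : forall i, e i · e i = e i.

Lemma split_subproof i : (mid _ - e i) · e i = 0.
Proof. by rewrite mcompBl mcomp1m e_idem subrr. Qed.

Definition split_in i : mor (ker (mid _ - e i)) (X i) := ker_i (mid _ - e i).
Definition split_out i : mor (X i) (ker (mid _ - e i)) := ker_lift (split_subproof i).

Lemma split_outK i : split_in i · split_out i = e i.
Proof. exact: ker_liftK. Qed.

Lemma e_split_in i : e i · split_in i = split_in i.
Proof.
have := (ker_iP (mid (X i) - e i)).1.
by rewrite mcompBl mcomp1m => /subr0_eq/esym.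
Qed.

Lemma split_inK i : split_out i · split_in i = mid _.
Proof.
apply: (@ker_i_mono _ _ _ (mid _ - e i)).
by rewrite mcompA split_outK e_split_in mcompm1.
Qed.

Let split_diff i := split_out (i + 1) · diff X i · split_in i.

(** The hypothesis says that the differential preserves the image of [e]. It need not preserve the
    kernel, so [r] is only a family of maps. *)
Lemma split_subcomplex :
  (forall i, e (i + 1) · diff X i · e i = diff X i · e i) ->
  exists (Q : complex A) (j : chain_map Q X) (r : forall i, mor (X i) (Q i)),
    (forall i, r i · j i = mid _) /\ (forall i, j i · r i = e i).
Proof.
move=> ede; have jd i : diff X i · split_in i = split_in (i + 1) · split_diff i.
  by rewrite /split_diff !mcompA split_outK -e_split_in !mcompA ede.
have dd i : split_diff (i + 1) · split_diff i = 0.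
  by rewrite {1}/split_diff -!mcompA -jd (mcompA (diff X (i + 1))) diffK mcomp0m mcompm0.
exists (Complex dd), (@ChainMap A (Complex dd) X split_in jd), split_out.
by split=> i; [exact: split_inK | exact: split_outK].
Qed.

Lemma split_quotient :
  (forall i, e (i + 1) · diff X i · e i = e (i + 1) · diff X i) ->
  exists (Q : complex A) (r : chain_map X Q) (j : forall i, mor (Q i) (X i)),
    (forall i, r i · j i = mid _) /\ (forall i, j i · r i = e i).
Proof.
move=> ede; have rd i : split_diff i · split_out i = split_out (i + 1) · diff X i.
  rewrite /split_diff -!mcompA split_outK !mcompA.
  apply: (@ker_i_mono _ _ _ (mid _ - e (i + 1))).
  by rewrite !(mcompA (ker_i _)) split_outK ede.
have dd i : split_diff (i + 1) · split_diff i = 0.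
  rewrite {2}/split_diff !mcompA rd -(mcompA (split_out _)) diffK.
  by rewrite mcompm0 mcomp0m.
exists (Complex dd), (@ChainMap A X (Complex dd) split_out rd), split_in.
by split=> i; [exact: split_inK | exact: split_outK].
Qed.

End Splitting.

(** * Brutal truncations and homotopy idempotents *)

Section BrutalTruncation.
Variable A : abelian_category.
Implicit Types X Y Z P I : complex A.

Lemma brutal_sub P (n : int) :
  exists (Q : complex A) (j : chain_map Q P) (r : forall i, mor (P i) (Q i)),
    [/\ forall i, r i · j i = mid _, forall i, n <= i -> j i · r i = mid _
      & forall i, i < n -> is_zero (Q i)].
Proof.
pose e i : mor (P i) (P i) := if n <= i then mid _ else 0.
have [||Q [j [r [rj jr]]]] := @split_subcomplex _ P e.
- by move=> i; rewrite /e; case: ifP; rewrite ?mcomp1m ?mcomp0m.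
- move=> i; rewrite /e; case: (leP n i) => ni; last by rewrite !mcompm0.
  by rewrite (le_trans ni) ?lerDl // mcomp1m.
exists Q, j, r; split=> // i ni; first by rewrite jr /e ni.
apply: is_zero_mid; rewrite -(rj i) -[r i]mcomp1m -(rj i) -(mcompA (r i)) jr.
by rewrite /e leNgt ni mcompm0 mcomp0m.
Qed.

Lemma brutal_quotient I (n : int) :
  exists (Q : complex A) (r : chain_map I Q) (j : forall i, mor (Q i) (I i)),
    [/\ forall i, r i · j i = mid _, forall i, i <= n -> j i · r i = mid _
      & forall i, n < i -> is_zero (Q i)].
Proof.
pose e i : mor (I i) (I i) := if i <= n then mid _ else 0.
have [||Q [r [j [rj jr]]]] := @split_quotient _ I e.
- by move=> i; rewrite /e; case: ifP; rewrite ?mcomp1m ?mcomp0m.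
- move=> i; rewrite /e; case: (leP (i + 1) n) => ni; last by rewrite !mcomp0m.
  by rewrite (le_trans _ ni) ?lerDl // mcompm1.
exists Q, r, j; split=> // i ni; first by rewrite jr /e ni.
apply: is_zero_mid; rewrite -(rj i) -[r i]mcomp1m -(rj i) -(mcompA (r i)) jr.
by rewrite /e leNgt ni mcompm0 mcomp0m.
Qed.

(** The null-homotopy on [Q] is extended through [r]. From degree [n] on, [j · r] is the identity
    and [r] commutes with the differential; below [n] both sides land in zero objects. *)
Lemma brutal_sub_null P Q X (j : chain_map Q P) (r : forall i, mor (P i) (Q i))
    (n : int) (p : chain_map P X) :
  (forall i, r i · j i = mid _) -> (forall i, n <= i -> j i · r i = mid _) ->
  (forall i, i < n -> is_zero (X i)) ->
  null_homotopic (cm_comp p j) -> null_homotopic p.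
Proof.
move=> rj jr Xn [s sE]; exists (fun i => s i · r (i + 1)) => i.
case: (leP n (i + 1)) => ni; last first.
  by rewrite (is_zero_hom0 (p _)) ?[RHS]is_zero_hom0 //; right; exact: Xn.
have jr1 := jr _ ni.
have rd : r (i + 1 + 1) · diff P (i + 1) = diff Q (i + 1) · r (i + 1).
  rewrite -[LHS]mcompm1 -jr1 -mcompA (mcompA (diff P _)) cmapE !mcompA rj.
  by rewrite mcomp1m.
rewrite -mcompA rd !mcompA -mcompDl -sE /= -mcompA jr1.
by rewrite mcompm1.
Qed.

(** The shift raises degrees by one, so [Z] must vanish from [n] itself on: in degree [i + 1 < n]
    the values lie in [I (i + 2)], where [j · r] is still the identity. *)
Lemma brutal_quotient_null I Q Z (r : chain_map I Q) (j : forall i, mor (Q i) (I i))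
    (n : int) (p : chain_map Z (cshift I)) :
  (forall i, r i · j i = mid _) -> (forall i, i <= n -> j i · r i = mid _) ->
  (forall i, n <= i -> is_zero (Z i)) ->
  null_homotopic (cm_comp (cshift_map r) p) -> null_homotopic p.
Proof.
move=> rj jr Zn [s sE].
pose s' i : mor (Z (i + 1)) (cshift I i) := j (i + 1) · s i.
exists s' => i; rewrite /s'.
case: (leP n (i + 1)) => ni.
  by rewrite (is_zero_hom0 (p _)) ?[RHS]is_zero_hom0 //; left; exact: Zn.
have jr2 : j (i + 1 + 1) · r (i + 1 + 1) = mid _ by apply: jr; rewrite lezD1.
have dj : diff I (i + 1) · j (i + 1) = j (i + 1 + 1) · diff Q (i + 1).
  by rewrite -[LHS]mcomp1m -jr2 -mcompA (mcompA (r _)) -cmapE -!mcompA rj mcompm1.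
rewrite /= mcompNm (mcompA (diff I _)) dj.
have -> : p (i + 1) = j (i + 1 + 1) · (r (i + 1 + 1) · p (i + 1)).
  by rewrite mcompA jr2 mcomp1m.
by rewrite [r _ · _]sE mcompDr /= mcompNm mcompmN !mcompA.
Qed.

(** Cutting [s] off outside [c] to [s'], put [e = 1 - (d s' + s' d)]. In degree [i + 1] it is 0 if
    [c] holds at [i] and [i + 1], [s d] if only at [i], [d s] if only at [i + 1], and 1 otherwise;
    the mixed cases are idempotent because [d s d = d]. *)
Lemma contraction_idempotent X (s : forall i, mor (X (i + 1)) (X i))
    (c : int -> bool) :
  (forall i, c i || c (i + 1) ->
    mid _ = diff X i · s i + s (i + 1) · diff X (i + 1)) ->
  exists e : chain_map X X, [/\ homotopic e (cm_id X), forall i, e i · e i = e i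
    & forall i, c i -> c (i + 1) -> e (i + 1) = 0].
Proof.
move=> sE; pose s' i : mor (X (i + 1)) (X i) := if c i then s i else 0.
have [e [e1 eE]] := perturb_chain_map (cm_id X) s'.
exists e; split; first exact: homotopic_sym.
- apply: int_succP => i; rewrite eE /s' /=.
  case ci: (c i); case ci1: (c (i + 1)); rewrite ?mcompm0 ?mcomp0m ?addr0 ?add0r.
  + by rewrite -sE ?ci // subrr mcomp0m.
  + rewrite [mid _]sE ?ci // addrACK -mcompA; congr (_ · _).
    rewrite -[RHS]mcompm1 [mid _]sE ?ci // mcompDr !mcompA diffK mcomp0m add0r.
    by [].
  + rewrite [mid _]sE ?ci1 ?orbT // addrK mcompA; congr (_ · _).
    rewrite -[RHS]mcomp1m [mid _]sE ?ci1 ?orbT // mcompDl -(mcompA (s _)) diffK.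
    by rewrite mcompm0 addr0.
  + by rewrite subr0 mcompm1.
- by move=> i ci ci1; rewrite eE /s' ci ci1 /= -sE ?ci // subrr.
Qed.

(** Since [e] is a chain map, the retraction onto its image is one too, and [e] being homotopic to
    the identity makes the image homotopy equivalent to [X]. *)
Lemma split_homotopy_idempotent (P : A -> Prop) X (e : chain_map X X) :
  strictly_additive P -> (forall i, P (X i)) ->
  homotopic e (cm_id X) -> (forall i, e i · e i = e i) ->
  exists (Q : complex A) (j : chain_map Q X) (r : chain_map X Q),
    [/\ quasi_iso j, quasi_iso r, forall i, P (Q i)
      & forall i, is_zero (X i) \/ e i = 0 -> is_zero (Q i)].
Proof.
move=> addP PX e1 ee.
have [|Q [j [r [rj jr]]]] := split_subcomplex ee.
  by move=> i; rewrite -cmapE -mcompA ee.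
have rC i : diff Q i · r i = r (i + 1) · diff X i.
  rewrite -[LHS]mcomp1m -rj -mcompA (mcompA (j _)) -cmapE -mcompA jr cmapE -jr.
  by rewrite !mcompA rj mcomp1m.
pose r' := ChainMap rC.
have rj1 : homotopic (cm_comp r' j) (cm_id Q).
  have -> : cm_comp r' j = cm_id Q by apply: chain_map_eq => i; exact: rj.
  exact: homotopic_refl.
have jr1 : homotopic (cm_comp j r') (cm_id X).
  by have -> : cm_comp j r' = e by apply: chain_map_eq => i; exact: jr.
exists Q, j, r'; split.
- exact: homotopy_equivalence_quasi_iso rj1 jr1.
- exact: homotopy_equivalence_quasi_iso jr1 rj1.
- by move=> i; exact: strictly_additive_retract addP (rj i) (PX i).
- move=> i [X0|e0]; first exact: is_zero_retract (rj i) X0.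
  apply: is_zero_mid; rewrite -(rj i) -[r i]mcomp1m -(rj i) -(mcompA (r i)) jr e0.
  by rewrite mcompm0 mcomp0m.
Qed.

End BrutalTruncation.

(** * Canonical truncations *)

Section SmartTruncation.
Variables (A : abelian_category) (X : complex A) (n : int).

(* The kernel of [smart_mor i] is [X i] below degree [n], the cocycles in
   degree [n], and zero above. *)
Definition smart_mor i : mor (X i) (biprod (X (i + 1)) (X i)) :=
  mpair (if i == n then diff X i else 0) (if n < i then mid _ else 0).

Lemma smart_morP W i (y : mor W (X i)) :
  smart_mor i · y = 0 <-> (i = n -> diff X i · y = 0) /\ (n < i -> y = 0).
Proof.
split=> [y0|[y1 y2]].
  split=> [/eqP iN|ni].
    have /(congr1 (fun u => prl_ _ _ · u)) := y0.
    by rewrite mcompA prl_mpair iN mcompm0.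
  have /(congr1 (fun u => prr_ _ _ · u)) := y0.
  by rewrite mcompA prr_mpair ni mcomp1m mcompm0.
apply: biprod_ext; rewrite mcompm0 mcompA ?prl_mpair ?prr_mpair.
  by case: eqP => [/y1//|_]; rewrite mcomp0m.
by case: ifP => [/y2->|_]; rewrite ?mcompm0 ?mcomp0m.
Qed.

(** [S] is the canonical truncation of [X] in degrees at most [n] and [T] is the quotient of [X] by
    [S]. The first group of properties says that the sequence is short exact, the second describes
    it degree by degree. *)
Lemma smart_truncation :
  exists (S T : complex A) (k : chain_map S X) (p : chain_map X T),
    [/\ forall i, mono (k i), forall i, epi (p i), forall i, p i · k i = 0
      & forall i W (y : mor W (X i)), p i · y = 0 ->
          exists W' (c : mor W' W) t, epi c /\ k i · t = y · c] /\
    [/\ forall i W (y : mor W (X i)), i < n -> exists t, k i · t = y,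
        forall W (y : mor W (X n)), diff X n · y = 0 -> exists t, k n · t = y,
        forall i, n < i -> is_zero (S i),
        forall i, i < n -> is_zero (T i)
      & forall i W (y : mor W (X i)), n < i -> p i · y = 0 -> y = 0].
Proof.
have kP i := (smart_morP (ker_i (smart_mor i))).1 (ker_iP _).1.
have dk i : smart_mor (i + 1) · (diff X i · ker_i (smart_mor i)) = 0.
  apply/smart_morP; split=> [_|]; first by rewrite mcompA diffK mcomp0m.
  rewrite ltzD1 le_eqVlt => /predU1P[iN|ni].
    exact: (kP i).1 (esym iN).
  by rewrite (kP i).2 // mcompm0.
pose dS i := ker_lift (dk i).
have dSE i : diff X i · ker_i (smart_mor i) = ker_i (smart_mor (i + 1)) · dS i.
  by rewrite ker_liftK.
have dSK i : dS (i + 1) · dS i = 0.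
  apply: (@ker_i_mono _ _ _ (smart_mor (i + 1 + 1))).
  by rewrite mcompA -dSE -mcompA -dSE mcompA diffK mcompm0 mcomp0m.
have pd i : coker_p (ker_i (smart_mor (i + 1))) · diff X i · ker_i (smart_mor i) = 0.
  by rewrite -mcompA dSE mcompA (coker_pP _).1 mcomp0m.
pose dT i := coker_desc (pd i).
have dTE i : dT i · coker_p (ker_i (smart_mor i)) =
    coker_p (ker_i (smart_mor (i + 1))) · diff X i.
  by rewrite coker_descK.
have dTK i : dT (i + 1) · dT i = 0.
  apply: (@coker_p_epi _ _ _ (ker_i (smart_mor i))).
  by rewrite -mcompA dTE mcompA dTE -mcompA diffK mcompm0 mcomp0m.
have sub i W (y : mor W (X i)) : (i = n -> diff X i · y = 0) -> i <= n ->
    exists t, ker_i (smart_mor i) · t = y.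
  move=> y1 ni; apply: ker_factor; apply/smart_morP; split=> //.
  by rewrite ltNge ni.
have S0 i : n < i -> is_zero (ker (smart_mor i)).
  move=> ni; apply: is_zero_mid; apply: (@ker_i_mono _ _ _ (smart_mor i)).
  by rewrite mcompm0 mcompm1; exact: (kP i).2.
have T0 i : i < n -> is_zero (coker (ker_i (smart_mor i))).
  move=> ni; have [|t tE] := sub i _ (mid _) _ (ltW ni).
    by move=> iN; rewrite iN ltxx in ni.
  apply: is_zero_mid; apply: (@coker_p_epi _ _ _ (ker_i (smart_mor i))).
  by rewrite mcomp0m mcomp1m -[LHS]mcompm1 -tE mcompA (coker_pP _).1 mcomp0m.
exists (Complex dSK), (Complex dTK).
exists (@ChainMap A (Complex dSK) X (fun i => ker_i (smart_mor i)) dSE).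
exists (@ChainMap A X (Complex dTK) (fun i => coker_p (ker_i (smart_mor i))) dTE).
split; split=> //=.
- by move=> i; exact: ker_i_mono.
- by move=> i; exact: coker_p_epi.
- by move=> i; exact: (coker_pP _).1.
- by move=> i W y /coker_exact.
- by move=> i W y ni; apply: sub (ltW ni) => iN; rewrite iN ltxx in ni.
- by move=> W y dy; exact: sub.
- move=> i W y ni /coker_exact[W' [c [t [ec tE]]]]; apply: (epi_eq0 ec).
  by rewrite -tE (is_zero_hom0 (t)) ?mcompm0 //; right; exact: S0.
Qed.

End SmartTruncation.

Section SmartTruncationQuasiIso.
Variables (A : abelian_category) (X : complex A) (n : int).

(** Exactness up to degree [n] means that passing to the quotient [T] loses no cohomology. Maps to
    [V] factor because [V] vanishes up to [n] and the kernel of [p] above it. *)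
Lemma smart_quotient :
  (forall i, i + 1 <= n -> exact_at (diff X i) (diff X (i + 1))) ->
  exists (T : complex A) (p : chain_map X T),
    [/\ quasi_iso p, forall i, i < n -> is_zero (T i),
        forall i, is_zero (X i) -> is_zero (T i)
      & forall V (q : chain_map X V), (forall i, i <= n -> is_zero (V i)) ->
          exists q' : chain_map T V, cm_comp q' p = q].
Proof.
move=> exX; have [S [T [k [p [[_ ep pk kerp] [_ _ S0 T0 injp]]]]]] :=
  smart_truncation X n.
exists T, p; split=> //.
- apply: coh_quasi_iso => i W.
    move=> y t dy pt; case: (leP (i + 1) n) => ni; first exact: exX.
    have [W' [c [t' [ec t'E]]]] := pullback_epi t (ep i).
    exists W', c, t'; split=> //; apply/esym/subr0_eq/injp => //.
    rewrite mcompBr (mcompA (p _) y) pt (mcompA (p _) (diff X i)) -cmapE -!mcompA t'E.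
    by rewrite mcompA subrr.
  move=> z dz; case: (ltP (i + 1) n) => ni.
    exists W, (mid W), 0, 0; split; [exact: epi_mid|exact: mcompm0|].
    by rewrite (is_zero_hom0 z) ?mcomp0m ?mcompm0 ?addr0 //; right; exact: T0.
  have [W' [c [y [ec yE]]]] := pullback_epi z (ep (i + 1)).
  exists W', c, y, 0; split=> //; last by rewrite mcompm0 addr0.
  apply: injp; first by rewrite ltzD1.
  by rewrite mcompA -cmapE -mcompA yE mcompA dz mcomp0m.
- move=> i [_ X0]; split=> W f; last first.
    have [W' [c [y [ec yE]]]] := pullback_epi f (ep i).
    by apply: (epi_eq0 ec); rewrite -yE [y]X0 mcompm0.
  have [W' [c [y [ec yE]]]] := pullback_epi (mid (T i)) (ep i).
  by apply: (epi_eq0 ec); rewrite -[c]mcomp1m -yE [y]X0 !mcompm0.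
- move=> V q V0.
  have /(family_choice (Q := fun i (v : mor (T i) (V i)) => v · p i = q i))[q' q'E] i :
      exists v : mor (T i) (V i), v · p i = q i.
    have [W [g [pg0 gP]]] := epi_conormal (ep i).
    have [|v [vE _]] := gP _ (q i); last by exists v.
    have [W' [c [t [ec tE]]]] := kerp _ _ _ pg0.
    apply: (epi_eq0 ec); rewrite -mcompA -tE.
    case: (leP i n) => ni; first by apply: is_zero_hom0; right; exact: V0.
    by rewrite (is_zero_hom0 t) ?mcompm0 //; right; exact: S0.
  have q'C i : diff V i · q' i = q' (i + 1) · diff T i.
    by apply: (ep i); rewrite -mcompA q'E cmapE -q'E -!mcompA cmapE.
  by exists (ChainMap q'C); apply: chain_map_eq => i; exact: q'E.
Qed.

(** Exactness above [n] means that [S] carries all the cohomology. In degree [n] it contains only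
    the cocycles, so maps from [V] factor when [V] vanishes already from [n] on. *)
Lemma smart_subcomplex :
  (forall i, n < i + 1 -> exact_at (diff X i) (diff X (i + 1))) ->
  exists (S : complex A) (k : chain_map S X),
    [/\ quasi_iso k, forall i, n < i -> is_zero (S i),
        forall i, is_zero (X i) -> is_zero (S i)
      & forall V (q : chain_map V X), (forall i, n <= i -> is_zero (V i)) ->
          exists q' : chain_map V S, cm_comp k q' = q].
Proof.
move=> exX; have [S [T [k [p [[mk _ _ _] [subk cock S0 _ _]]]]]] :=
  smart_truncation X n.
exists S, k; split=> //.
- apply: coh_quasi_iso => i W.
    move=> y t dy kt; exists W, (mid W); case: (leP (i + 1) n) => ni.
      have [|t' t'E] := subk i _ t; first by rewrite -lezD1.
      exists t'; split; first exact: epi_mid.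
      by apply: (mk (i + 1)); rewrite mcompm1 (mcompA (k _)) -cmapE -mcompA t'E kt.
    exists 0; split; first exact: epi_mid.
    by rewrite mcompm0 mcompm1 (is_zero_hom0 y) //; right; exact: S0.
  move=> z dz; case: (leP (i + 1) n) => ni; last first.
    have [W' [c [t [ec tE]]]] := exX i ni _ _ dz.
    by exists W', c, 0, t; split; rewrite ?mcompm0 ?add0r.
  have [y yE] : exists y, k (i + 1) · y = z.
    move: ni z dz; rewrite le_eqVlt => /predU1P[iN|ni z dz]; last exact: subk.
    by rewrite iN; exact: cock.
  exists W, (mid W), y, 0; split; first exact: epi_mid.
    by apply: (mk (i + 1 + 1)); rewrite (mcompA (k _)) -cmapE -mcompA yE dz mcompm0.
  by rewrite mcompm1 mcompm0 addr0 yE.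
- move=> i [X0 X0']; apply: is_zero_mid; apply: (mk i).
  by rewrite mcompm0 mcompm1; exact: X0'.
- move=> V q V0.
  have /(family_choice (Q := fun i (v : mor (V i) (S i)) => k i · v = q i))[q' q'E] i :
      exists v : mor (V i) (S i), k i · v = q i.
    case: (ltP i n) => ni; first exact: subk.
    by exists 0; rewrite mcompm0; apply/esym/is_zero_hom0; left; exact: V0.
  have q'C i : diff S i · q' i = q' (i + 1) · diff V i.
    by apply: (mk (i + 1)); rewrite !mcompA q'E -!cmapE -mcompA q'E.
  by exists (ChainMap q'C); apply: chain_map_eq => i; exact: q'E.
Qed.

End SmartTruncationQuasiIso.

Section CategoryTransport.
Variable C : category.

Lemma is_retraction_iso (Y Z Y' Z' : C) (g : hom Y Z) (g' : hom Y' Z')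
    (b : hom Y Y') (c : hom Z Z') :
  is_iso b -> is_iso c -> c ∘ g = g' ∘ b -> is_retraction g' -> is_retraction g.
Proof.
move=> [b' [_ bb']] [c' [c'c _]] cg [s gs]; exists (b' ∘ s ∘ c).
rewrite -[LHS]ccomp1m -c'c -ccompA (ccompA c) cg -!ccompA (ccompA b) bb' ccomp1m.
by rewrite (ccompA g') gs ccomp1m.
Qed.

Lemma is_section_iso (X Y X' Y' : C) (f : hom X Y) (f' : hom X' Y')
    (a : hom X X') (b : hom Y Y') :
  is_iso a -> b ∘ f = f' ∘ a -> is_section f' -> is_section f.
Proof.
move=> [a' [a'a _]] bf [s sf]; exists (a' ∘ s ∘ b).
by rewrite -!ccompA bf (ccompA s) sf ccomp1m.
Qed.

Lemma fhom_iso (D : category) (F : functor C D) (X Y : C) (a : hom X Y) :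
  is_iso a -> is_iso (fhom F a).
Proof.
by move=> [c [ca ac]]; exists (fhom F c); rewrite -!fhom_comp ca ac !fhom_id.
Qed.

Variable W : forall X Y : C, hom X Y -> Prop.

Lemma loc_map_comp (X Y Z : C) (g : hom Y Z) (f : hom X Y) :
  loc_map W (g ∘ f) = @ccomp (localization W) _ _ _ (loc_map W g) (loc_map W f).
Proof. by rewrite [RHS]loc_compE; apply/esym/loc_classP; exact: zz_comp. Qed.

Lemma loc_map_iso (X Y : C) (s : hom X Y) :
  W s -> @is_iso (localization W) X Y (loc_map W s).
Proof.
move=> Ws; exists (loc_class (zz_bwd Ws (zz_nil W X))).
by split; rewrite [LHS]loc_compE; apply/loc_classP; [exact: zz_fb|exact: zz_bf].
Qed.

End CategoryTransport.

(** * Split maps in the derived category *)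

Section SplitInDerived.
Variables (A : abelian_category) (b : boundedness).

Local Notation CA := (bounded_complexes b A).
Local Notation qis := (@bounded_quasi_iso b A).
Local Notation DA := (localization qis).

(** A map [t] of the category with [g ∘ t] a quasi-isomorphism gives the section [t] composed with
    the inverse of [g ∘ t]. The task is to replace [p] by such a map with source satisfying [b]. *)
Lemma loc_map_retraction (V C : CA) (g : hom V C) (P : complex A)
    (p : chain_map P (sval V)) :
  bounded_above P -> quasi_iso (cm_comp g p) ->
  @is_retraction DA V C (loc_map qis g).
Proof.
have reduce (T : CA) (t : hom T V) : qis (g ∘ t) ->
    @is_retraction DA V C (loc_map qis g).
  move=> /loc_map_iso[s [_ gts]]; exists (loc_map qis t ∘ s).
  by rewrite ccompA -loc_map_comp gts.
(* If [P] violates [b], then [b] imposes a lower bound, so [V] and [C] vanish in low degrees. There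
   [P] is exact, and [p] factors through a canonical quotient of [P]. *)
move=> bP qgp; have [bb|nb] := EM (has_bound b P).
  exact: (reduce (exist _ P bb) p).
have [m V0 C0] : exists2 m : int, forall i, i < m -> is_zero (sval V i)
    & forall i, i < m -> is_zero (sval C i).
  have [[m Vm] [m' Cm']] : bounded_below (sval V) /\ bounded_below (sval C).
    case: V C {reduce g p qgp} => V hV [C hC] /=.
    by move: nb hV hC; case: b => //= _ [? _] [].
  by exists (Order.min m m') => i; rewrite lt_min => /andP[/Vm ? /Cm'].
have [i im|T [t [qt T0 TP tP]]] := @smart_quotient _ P (m - 1).
  move=> W y dy; have [|W' [c [t' [ec t'E]]]] :=
      quasi_iso_coh_injective qgp (t := 0) dy.
    rewrite mcompm0; apply: is_zero_hom0; right; apply: C0.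
    by rewrite (le_lt_trans im) // ltrBlDr ltrDl.
  by exists W', c, t'.
have [i im|p' p'E] := tP _ p.
  by apply: V0; rewrite (le_lt_trans im) // ltrBlDr ltrDl.
have bT : has_bound b T.
  have lo : bounded_below T by exists (m - 1).
  have hi : bounded_above T by case: bP => n Pn; exists n => i /Pn /TP.
  by case: (b).
apply: (reduce (exist _ T bT) p'); apply: (quasi_iso_2of3l qt).
by rewrite -cm_compA p'E.
Qed.

Lemma loc_map_section (U V : CA) (g : hom U V) (I : complex A)
    (p : chain_map (sval V) I) :
  bounded_below I -> quasi_iso (cm_comp p g) ->
  @is_section DA U V (loc_map qis g).
Proof.
have reduce (S : CA) (t : hom V S) : qis (t ∘ g) ->
    @is_section DA U V (loc_map qis g).
  move=> /loc_map_iso[s [tgs _]]; exists (s ∘ loc_map qis t).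
  by rewrite -ccompA -loc_map_comp tgs.
move=> bI qpg; have [bb|nb] := EM (has_bound b I).
  exact: (reduce (exist _ I bb) p).
have [m U0 V0] : exists2 m : int, forall i, m < i -> is_zero (sval U i)
    & forall i, m < i -> is_zero (sval V i).
  have [[m Um] [m' Vm']] : bounded_above (sval U) /\ bounded_above (sval V).
    case: U V {reduce g p qpg} => U hU [V hV] /=.
    by move: nb hU hV; case: b => //= _ [_ ?] [].
  by exists (Order.max m m') => i; rewrite gt_max => /andP[/Um ? /Vm'].
(* The cut is at [m + 1] because the factorization requires [V] to vanish in the cutting degree as
   well. *)
have [i im|S [k [qk S0 SI kP]]] := @smart_subcomplex _ I (m + 1).
  move=> W z dz; have [W' [c [y [t [ec dy yE]]]]] := quasi_iso_coh_surjective qpg dz.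
  exists W', c, t; split=> //; rewrite yE (is_zero_hom0 y) ?mcompm0 ?add0r //.
  by right; apply: U0; apply: lt_trans im; rewrite ltrDl.
have [i im|p' p'E] := kP _ p.
  by apply: V0; rewrite -lezD1.
have bS : has_bound b S.
  have hi : bounded_above S by exists (m + 1).
  have lo : bounded_below S by case: bI => n In; exists n => i /In /SI.
  by case: (b).
apply: (reduce (exist _ S bS) p'); apply: (quasi_iso_2of3r qk).
by rewrite cm_compA p'E.
Qed.

End SplitInDerived.

(** * Almost split triangles *)

Section AlmostSplit.
Variables (A : abelian_category) (b : boundedness).
Variables (X Y Z : derived b A) (f : hom X Y) (g : hom Y Z) (h : hom Z (shift X)).
Hypothesis exact_fgh : exact_triangle f g h.

Local Notation CA := (bounded_complexes b A).
Local Notation qis := (@bounded_quasi_iso b A).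
Local Notation S := (derived_shift b A).

Lemma finite_projective_resolution (P : A -> Prop) :
  right_almost_split g -> bounded_below (complex_of X) ->
  strictly_additive P -> (forall U, P U -> projective U) ->
  has_resolution BoundedAbove P (complex_of Z) ->
  has_resolution Bounded P (complex_of Z).
Proof.
move=> [g_nr g_ras] [m X0] addP projP [Q [q [[bQ PQ] qq]]].
have projQ i := projP _ (PQ i).
(* [X] vanishes below [m], hence its shift below [m - 1]. *)
pose N := m - 1; have [Q' [j [r [rj jr Q'0]]]] := brutal_sub Q N.
have PQ' i : P (Q' i) := strictly_additive_retract addP (rj i) (PQ i).
have projQ' i := projP _ (PQ' i).
have bQ' : bounded_above Q'.
  by have [n Qn] := bQ; exists n => i /Qn; exact: is_zero_retract (rj i).
(* [Q'] is bounded on both sides, so it is an object for every [b]. [Q] need not be one and enters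
   only through maps out of it. *)
have hbQ' : has_bound b Q'.
  have lo : bounded_below Q' by exists N.
  by case: (b).
pose BQ' : CA := exist _ Q' hbQ'; pose ZC : CA := Z.
pose E := @from_relations A b Q bQ projQ.
pose E' := @from_relations A b Q' bQ' projQ'.
pose u : @hom CA BQ' ZC := cm_comp q j.
have [[v uv]|u_nr] := EM (@is_retraction (derived b A) BQ' Z (loc_map qis u)).
  (* Applying the section [v] to the class of [q] gives [s] from [Q] to [Q'] with [q j s] homotopic
     to [q]; cancelling [q] makes [j s] homotopic to the identity. *)
  have [s vqs] := @loc_rel_total _ _ E Z BQ' v q (@from_rel_total _ _ _ _ _).
  have /loc_rel_id qus : @loc_rel _ _ E Z Z (idm Z) q (cm_comp u s).
    rewrite -uv; apply/loc_rel_comp; exists s => //.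
    by apply/loc_rel_map; exact: homotopic_refl.
  have [t tE] : homotopic (cm_id Q) (cm_comp j s).
    apply: (projective_homotopic_cancel qq bQ projQ).
    by rewrite cm_compm1 cm_compA.
  (* Below [N] the map [j s] is zero, so [t] contracts [Q] there. *)
  have [i /= ci|e [e1 ee e0]] := @contraction_idempotent _ Q t (fun i => i + 1 < N).
    have iN : i + 1 < N.
      by case/orP: ci => // /(lt_trans _); apply; rewrite ltrDl.
    rewrite -tE /= (is_zero_hom0 (s (i + 1))) ?mcompm0 ?subr0 //.
    by right; exact: Q'0.
  have [R [k [_ [qk _ PR R0]]]] := split_homotopy_idempotent addP PQ e1 ee.
  exists R, (cm_comp q k); split; last exact: quasi_iso_comp.
  split=> //; split; last by have [n Qn] := bQ; exists n => i /Qn; auto.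
  (* [e] vanishes in degree [i + 1] when both [i + 1] and [i + 2] are below [N], which costs one
     degree. *)
  exists (N - 1); apply: int_succP => i iN; apply: R0; right; apply: e0.
    by rewrite (lt_trans iN) // ltrBlDr ltrDl.
  by rewrite -ltrBrDr.
have [v gv] := g_ras _ _ u_nr.
have [w hqw] := @loc_rel_total _ _ E Z (S X) h q (@from_rel_total _ _ _ _ _).
have hqjwj : @loc_rel _ _ E' Z (S X) h (cm_comp q j) (cm_comp w j).
  apply: (@zz_rel_map _ _ E E' (fun U p => cm_comp p j)) hqw => /=.
    by move=> U p p'; exact: homotopic_compr.
  by move=> U V k p p' /(homotopic_compr j); rewrite /from_rel cm_compA.
have [U [V [l [a [c [d [[iso_a iso_c iso_d] [_ dg ah]]]]]]]] := exact_fgh.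
(* Evaluating [g ∘ v] at the identity of [Q'] gives a class [n] that [g] sends to [q j]. *)
have /loc_rel_comp[n _ gnu] :
    @loc_rel _ _ E' BQ' Z (g ∘ v) (cm_id Q') (cm_comp q j).
  by rewrite gv; apply/loc_rel_map; rewrite /= /from_rel cm_compm1; exact: homotopic_refl.
have iso_Sa := fhom_iso S iso_a.
have [x axw] := loc_rel_iso_total (E := E') iso_Sa (cm_comp w j).
(* Transported to the standard triangle, [h] applied to [g n] passes through two consecutive maps of
   the cone, whose composite is zero. *)
have x0 : homotopic x (cm_zero Q' _).
  have : @loc_rel _ _ E' Y _ (fhom S a ∘ h ∘ g) n x.
    apply/loc_rel_comp; exists (cm_comp q j) => //.
    by apply/loc_rel_comp; exists (cm_comp w j).
  rewrite ah -ccompA dg => /loc_rel_comp[y /loc_rel_comp[z _ /loc_rel_map zy]].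
  move=> /loc_rel_map yx.
  have := homotopic_trans (homotopic_compl (cone_out l) zy) yx.
  rewrite cm_compA => /homotopic_sym /homotopic_trans; apply.
  have -> : cm_comp (cone_out l) (cone_in l) = cm_zero _ _.
    by apply: chain_map_eq => i /=; rewrite prl_inr.
  by rewrite cm_comp0m; exact: homotopic_refl.
have wj0 : homotopic (cm_comp w j) (cm_zero Q' _).
  have Sa0 : @loc_rel _ _ E' _ _ (fhom S a) (cm_zero Q' _) (cm_zero Q' _).
    apply: (@loc_rel_point _ _ E' (fun W => cm_zero Q' (sval W))) => W1 W2 k.
    by rewrite /= /from_rel cm_compm0; exact: homotopic_refl.
  apply: (@loc_rel_iso_inj _ _ E' _ _ _ iso_Sa _ _ _ axw).
  exact: (@loc_rel_eqrel _ _ E' _ _ _ _ _ _ _ (lr_refl _) (homotopic_sym x0) Sa0).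
have w0 : homotopic w (cm_zero Q _).
  apply/homotopic0; apply: (brutal_sub_null rj jr); last exact/homotopic0.
  by move=> i; rewrite ltrBrDr; exact: X0.
(* Now [h] kills [q]. In the standard triangle the image [y] of [q] under [d] is a quasi-isomorphism
   that lifts to [V] up to homotopy, so the inclusion of [V] in the cone is a retraction, and so is
   [g]. *)
have : @loc_rel _ _ E Z _ (fhom S a ∘ h) q (cm_zero Q _).
  apply/loc_rel_comp; exists (cm_zero Q _).
    exact: (@loc_rel_eqrel _ _ E _ _ _ _ _ _ _ (lr_refl _) w0 hqw).
  apply: (@loc_rel_point _ _ E (fun W => cm_zero Q (sval W))) => W1 W2 k.
  by rewrite /= /from_rel cm_compm0; exact: homotopic_refl.
rewrite ah => /loc_rel_comp[y dqy /loc_rel_map y0].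
have qy := from_rel_iso_quasi_iso iso_d dqy qq.
have [y' y'E] : exists y' : chain_map Q (sval V), homotopic (cm_comp (cone_in l) y') y.
  by apply: cone_out_null_lift; apply/homotopic0.
case: g_nr; apply: (is_retraction_iso iso_c iso_d dg).
apply: (loc_map_retraction (p := y') bQ).
exact: quasi_iso_homotopic (homotopic_sym y'E) qy.
Qed.

Lemma finite_injective_coresolution (J : A -> Prop) :
  left_almost_split f -> bounded_above (complex_of Z) ->
  strictly_additive J -> (forall U, J U -> injective_object U) ->
  has_coresolution BoundedBelow J (complex_of X) ->
  has_coresolution Bounded J (complex_of X).
Proof.
move=> [f_ns f_las] [m Z0] addJ injJ [I [q [[bI JI] qq]]].
have injI i := injJ _ (JI i).
have bSI := @has_bound_cshift BoundedBelow _ _ bI.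
have injSI i : injective_object (cshift I i) := injI (i + 1).
(* [Z] vanishes above [m], that is from [N] on, as the extension of null-homotopies from [I'] to [I]
   requires. *)
pose N := m + 1; have [I' [r [j [rj jr I'0]]]] := brutal_quotient I N.
have JI' i : J (I' i) := strictly_additive_retract addJ (rj i) (JI i).
have injI' i := injJ _ (JI' i).
have bI' : bounded_below I'.
  by have [n In] := bI; exists n => i /In; exact: is_zero_retract (rj i).
have bSI' := @has_bound_cshift BoundedBelow _ _ bI'.
have injSI' i : injective_object (cshift I' i) := injI' (i + 1).
have hbI' : has_bound b I'.
  have hi : bounded_above I' by exists N.
  by case: (b).
pose BI' : CA := exist _ I' hbI'; pose XC : CA := X.
pose E := @to_relations A b I bI injI.
pose E' := @to_relations A b I' bI' injI'.
pose SE := @to_relations A b (cshift I) bSI injSI.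
pose SE' := @to_relations A b (cshift I') bSI' injSI'.
pose u : @hom CA XC BI' := cm_comp r q.
have [[v vu]|u_ns] := EM (@is_section (derived b A) X BI' (loc_map qis u)).
  (* Here [s] represents [q] composed with [v], so [s r q] is homotopic to [q] and [s r] to the
     identity of [I]. As [I'] vanishes above [N], the homotopy contracts [I] there. *)
  have [s vsq] := @loc_rel_surj _ _ E BI' X v q (@to_rel_surj _ _ _ _ _).
  have /loc_rel_id qsu : @loc_rel _ _ E X X (idm X) (cm_comp s u) q.
    rewrite -vu; apply/loc_rel_comp; exists s => //.
    by apply/loc_rel_map; exact: homotopic_refl.
  have [t tE] : homotopic (cm_id I) (cm_comp s r).
    apply: (injective_homotopic_cancel qq bI injI).
    by rewrite cm_comp1m -cm_compA; exact: homotopic_sym.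
  have [i /= ci|e [e1 ee e0]] := @contraction_idempotent _ I t (fun i => N < i).
    have iN : N < i + 1.
      by case/orP: ci => // /lt_trans; apply; rewrite ltrDl.
    rewrite -tE /= (is_zero_hom0 (s (i + 1))) ?mcomp0m ?subr0 //.
    by left; exact: I'0.
  have [R [_ [k [_ qk JR R0]]]] := split_homotopy_idempotent addJ JI e1 ee.
  exists R, (cm_comp k q); split; last exact: quasi_iso_comp.
  split=> //; split; first by have [n In] := bI; exists n => i /In; auto.
  exists (N + 1); apply: int_succP => i; rewrite ltrD2r => iN.
  apply: R0; right; apply: e0 => //.
  by rewrite (lt_trans iN) // ltrDl.
have [v vf] := f_las _ _ u_ns.
have [w hwq] := @loc_rel_surj _ _ SE Z (S X) h (cshift_map q) (@to_rel_surj _ _ _ _ _).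
have hrwrq : @loc_rel _ _ SE' Z (S X) h (cm_comp (cshift_map r) w)
    (cshift_map (cm_comp r q)).
  rewrite cshift_map_comp.
  apply: (@zz_rel_map _ _ SE SE' (fun U p => cm_comp (cshift_map r) p)) hwq => /=.
    by move=> U p p'; exact: homotopic_compl.
  by move=> U V k p p' /(homotopic_compl (cshift_map r)); rewrite /to_rel cm_compA.
have [U [V [l [a [c [d [[iso_a iso_c iso_d] [cf _ ah]]]]]]]] := exact_fgh.
have /loc_rel_comp[n nf _] :
    @loc_rel _ _ E' X BI' (v ∘ f) (cm_comp r q) (cm_id I').
  by rewrite vf; apply/loc_rel_map; rewrite /= /to_rel cm_comp1m; exact: homotopic_refl.
have [n' cnn'] := loc_rel_iso_total (E := E') iso_c n.
have Sf := loc_rel_cshift bSI' injSI' nf.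
have Sc := loc_rel_cshift bSI' injSI' cnn'.
(* The composite of [h] with the shift of [f] is zero: in the standard triangle it becomes
   [cone_out] followed by the shift of [l], which is null-homotopic. Since [r q] factors through
   [f], its shift dies on [h]. *)
have rw0 : homotopic (cm_comp (cshift_map r) w) (cm_zero _ (cshift I')).
  have : @loc_rel _ _ SE' Z _ (fhom S c ∘ (fhom S f ∘ h)) (cm_comp (cshift_map r) w)
      (cshift_map n').
    apply/loc_rel_comp; exists (cshift_map n) => //.
    by apply/loc_rel_comp; exists (cshift_map (cm_comp r q)).
  rewrite ccompA -fhom_comp cf fhom_comp -ccompA ah.
  move=> /loc_rel_comp[x /loc_rel_comp[y dy /loc_rel_map yx]].
  rewrite [fhom S _]loc_fhomE => /loc_rel_map xn'.
  have y0 : homotopic y (cm_zero _ (cshift I')).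
    apply: homotopic_trans yx _.
    apply: homotopic_trans (homotopic_compr (cone_out l) xn') _.
    rewrite -cm_compA -(cm_compm0 (sval (bounded_cone l)) (cshift_map n')).
    by apply: homotopic_compl; apply/homotopic0; exact: cone_rotate_null.
  apply: (@loc_rel_iso_inj _ _ SE' _ _ _ iso_d _ _ _ dy).
  apply: (@loc_rel_eqrel _ _ SE' _ _ _ _ _ _ _ (lr_refl _) (homotopic_sym y0)).
  apply: (@loc_rel_point _ _ SE' (fun W => cm_zero (sval W) (cshift I'))) => W1 W2 k.
  by rewrite /= /to_rel cm_comp0m; exact: homotopic_refl.
have w0 : homotopic w (cm_zero _ (cshift I)).
  apply/homotopic0; apply: (brutal_quotient_null rj jr); last exact/homotopic0.
  by move=> i; rewrite lezD1; exact: Z0.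
(* [k] is [q] carried over to [U], still a quasi-isomorphism. Its shift vanishes on the cone because
   the shift of [q] vanishes on [h], so [k] extends along [l] up to homotopy; then [l] is a section,
   and so is [f]. *)
have [k aqk] := loc_rel_iso_total (E := E) iso_a q.
have : @loc_rel _ _ SE Z _ (fhom S a ∘ h) (cm_zero _ (cshift I)) (cshift_map k).
  apply/loc_rel_comp; exists (cshift_map q).
    exact: (@loc_rel_eqrel _ _ SE _ _ _ _ _ _ _ w0 (lr_refl _) hwq).
  exact: loc_rel_cshift aqk.
rewrite ah => /loc_rel_comp[y d0y /loc_rel_map yk].
have y0 : homotopic y (cm_zero _ (cshift I)).
  apply: (@loc_rel_iso_fun _ _ SE _ _ _ iso_d _ _ _ d0y).
  apply: (@loc_rel_point _ _ SE (fun W => cm_zero (sval W) (cshift I))) => W1 W2 t.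
  by rewrite /= /to_rel cm_comp0m; exact: homotopic_refl.
have qk := to_rel_iso_quasi_iso iso_a aqk qq.
have [k' k'E] : exists k' : chain_map (sval V) I, homotopic (cm_comp k' l) k.
  apply: cone_out_null_extend; apply/homotopic0.
  exact: homotopic_trans (homotopic_sym yk) y0.
case: f_ns; apply: (is_section_iso iso_a cf).
apply: (loc_map_section (p := k') bI).
exact: quasi_iso_homotopic (homotopic_sym k'E) qk.
Qed.

End AlmostSplit.

Theorem theorem5p2 (A : abelian_category) (b : boundedness)
    (X Y Z : derived b A) (f : hom X Y) (g : hom Y Z) (h : hom Z (shift X)) :
  almost_split_triangle f g h ->
  bounded_below (complex_of X) ->
  bounded_above (complex_of Z) ->
  (forall P : A -> Prop,
     strictly_additive P -> (forall U : A, P U -> projective U) ->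
     has_resolution BoundedAbove P (complex_of Z) ->
     has_resolution Bounded P (complex_of Z)) /\
  (forall I : A -> Prop,
     strictly_additive I -> (forall U : A, I U -> injective_object U) ->
     has_coresolution BoundedBelow I (complex_of X) ->
     has_coresolution Bounded I (complex_of X)).
Proof.
move=> [exact_fgh [_ f_las] [_ g_ras]] bX bZ; split=> P.
  exact: (finite_projective_resolution exact_fgh).
exact: (finite_injective_coresolution exact_fgh).
Qed.
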